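(* For $1\le j\le N$ let $\Omega_j$ be a compact subset of $\mathbb R$ supporting a non-atomic finite measure $m_j$ satisfying condition (A) with exponent $\delta_j$, and let $\Omega=\Omega_1\times\dots\times\Omega_N$. Then for every $N$-tuple $(i_1,\dots,i_N)$ with $i_j\ge0$ and $\sum_{j=1}^N i_j=1$, $$\dim\big(\Omega\cap\mathrm{Bad}(i_1,\dots,i_N)\big)=\dim\Omega.$$
   Context: $\dim$ is Hausdorff dimension. Condition (A) with exponent $\delta$ for a measure $\mu$ supported on a compact set $\Omega'$: there are $r_0>0$, $0<a\le1\le b$ with $ar^\delta\le\mu(B(c,r))\le br^\delta$ for all $c\in\Omega'$, $r\le r_0$. $\|y\|$ is the distance from $y\in\mathbb R$ to the nearest integer. For $i_1,\dots,i_N\ge0$ with $\sum i_r=1$, $\mathrm{Bad}(i_1,\dots,i_N)$ is the set of $(x_1,\dots,x_N)\in\mathbb R^N$ for which there is $c>0$ such that $\max_{r}\|qx_r\|^{1/i_r}>c\,q^{-1}$ for all $q\in\mathbb N$, where terms with $i_r=0$ are omitted from the maximum (so e.g. $\mathrm{Bad}(0,1)=\mathbb R\times\mathrm{Bad}$, with $\mathrm{Bad}$ the badly approximable reals). *)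

(* Defs.v *)
From HB Require Import structures.
From mathcomp Require Import all_boot all_order all_algebra.
From mathcomp Require Import all_classical all_reals all_analysis.
Set Implicit Arguments. Unset Strict Implicit. Unset Printing Implicit Defensive.
Import Order.TTheory GRing.Theory Num.Theory.
Import numFieldNormedType.Exports.
Local Open Scope classical_set_scope.
Local Open Scope ring_scope.

Section HausdorffDim.
Variables (R : realType) (N : nat).
Local Notation pt := ('I_N -> R).

(* sup-norm distance on R^N (any norm gives the same Hausdorff dimension) *)
Definition supdist (x y : pt) : R := \big[Num.max/0]_(j < N) `|x j - y j|.

Definition diam (A : set pt) : \bar R :=
  ereal_sup [set z | exists x y, A x /\ A y /\ z = (supdist x y)%:E].

Definition diam_pow (s : R) (A : set pt) : \bar R :=
  if pselect (A = set0) then 0%E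
  else match diam A with
       | r%:E => (r `^ s)%:E
       | _ => +oo%E
       end.

Definition hausdorff_delta (s delta : R) (E : set pt) : \bar R :=
  ereal_inf [set v | exists F : nat -> set pt,
     E `<=` \bigcup_n F n /\ (forall n, (diam (F n) <= delta%:E)%E) /\
     v = (\sum_(0 <= n <oo) diam_pow s (F n))%E].

Definition hausdorff_measure (s : R) (E : set pt) : \bar R :=
  ereal_sup [set hausdorff_delta s delta E | delta in [set d : R | 0 < d]].

Definition hausdorff_dim (E : set pt) : \bar R :=
  ereal_inf [set s%:E | s in [set s : R | 0 <= s /\ hausdorff_measure s E = 0%E]].
End HausdorffDim.

Definition dist_nearest_int (R : realType) (y : R) : R :=
  Num.min (y - (Num.floor y)%:~R) ((Num.ceil y)%:~R - y).

Definition Bad (R : realType) (N : nat) (i : 'I_N -> R) : set ('I_N -> R) :=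
  [set x | exists2 c : R, 0 < c & forall q : nat, (0 < q)%N ->
     \big[Num.max/0]_(r < N | 0 < i r) (dist_nearest_int (q%:R * x r) `^ (i r)^-1)
       > c * q%:R^-1].

Definition supported_on (R : realType) (mu : {measure set R -> \bar R}) (Om : set R) :=
  mu (~` Om) = 0%E.

Definition non_atomic (R : realType) (mu : {measure set R -> \bar R}) :=
  forall x : R, mu [set x] = 0%E.

Definition finite_meas (R : realType) (mu : {measure set R -> \bar R}) :=
  (mu setT < +oo)%E.

Definition condA (R : realType) (mu : {measure set R -> \bar R}) (Om : set R) (delta : R) :=
  exists r0 : R, exists a : R, exists b : R,
    [/\ 0 < r0, 0 < a, a <= 1, 1 <= b &
     forall c r, Om c -> 0 < r -> r <= r0 ->
       ((a * r `^ delta)%:E <= mu (ball c r) /\ mu (ball c r) <= (b * r `^ delta)%:E)%E].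

(* Main.v *)
(* Let sigma be the sum of the exponents delta_j. Condition (A) bounds the size of
   separated subsets of Omega_j from both sides; hence dim Omega <= sigma by
   covering with boxes, and it remains to show dim (Omega `&` Bad i) >= sigma.

   Fix a large integer k and consider boxes of level n with sides
   rho0 k^(-n(1+i_r)). By the simplex lemma (an integral determinant of absolute
   value < 1 vanishes), the rational points with denominator in [k^n, k^(n+1))
   that matter for a level-n box lie on one hyperplane, and at most half of
   the children in a grid of level-(n+1) boxes come close to it. Keeping the others
   at every level gives a Cantor set in Omega `&` Bad i whose nodes all
   have M children, where M >= kappa * prod_r k^((1+i_r) delta_r) and kappa does
   not depend on k. A set of diameter d meets at most a proportion C d^s of
   the nodes of a suitable level, where s tends to sigma as k grows. *)
Require Import Defs.
From HB Require Import structures.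
From mathcomp Require Import all_boot all_order all_algebra.
From mathcomp Require Import all_classical all_reals all_analysis.
From mathcomp Require Import perm lra ring zify.
Import Order.TTheory GRing.Theory Num.Theory.
Import numFieldNormedType.Exports.
Local Open Scope classical_set_scope.
Local Open Scope ring_scope.
Set Implicit Arguments. Unset Strict Implicit. Unset Printing Implicit Defensive.

(** The exponents 1 + i_r are those of the problem. For q in [k^n, k^(n+1)) the inequality defining
    [Bad] asks that some coordinate of positive weight stay farther than about q^-(1+i_r) from
    p_r/q, and up to a factor depending on k and [rho0] this is the side of a level n+1 box. So each
    level of the tree settles one range of denominators; the constant c may depend on k, which is
    fixed once the target exponent is.

    The obstacle is that the boxes are not cubes: no level has all its sides comparable to a given
    d. Nodes are counted at the level where k^-n is comparable to d, so that no side exceeds a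
    constant times d. Regularity, used in each coordinate separately, gives at most a constant times
    the product of (d k^(n(1+i_r)))^delta_r nodes. Dividing by M^n leaves d^sigma kappa^-n. The
    factor kappa^-n, caused by rounding and by discarding children, costs some dimension; since
    kappa is independent of k, taking k^eps >= 1/kappa bounds it by a constant times d^-eps. *)

(** * Separated sets and Ahlfors regular measures on the line *)

Definition spaced (R : realType) (t : R) (s : seq R) :=
  pairwise (fun x y => t <= `|x - y|) s.

(** Balls of half the spacing are pairwise disjoint, so their masses add up inside [A]. All upper
    bounds on cardinalities of separated sets come from this. *)
Lemma spaced_measure_le (R : realType) (mu : {measure set R -> \bar R})
    (rho w : R) (s : seq R) (A : set R) :
  0 < rho -> measurable A ->
  (forall x, x \in s -> ball x rho `<=` A) ->
  (forall x, x \in s -> (w%:E <= mu (ball x rho))%E) ->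
  spaced (2 * rho) s ->
  (((size s)%:R * w)%:E <= mu A)%E.
Proof.
move=> rho0 mA sA sw sep.
pose U := \bigcup_(x in [set` s]) ball x rho.
have mU : measurable U.
  apply: fin_bigcup_measurable; first exact: finite_seq.
  by move=> x _; exact: measurable_realfun.measurable_ball.
have UA : U `<=` A by move=> y [x /= xs]; exact: sA.
apply: le_trans (le_measure mu (mem_set mU) (mem_set mA) UA).
rewrite {mA sA UA A mU}/U.
elim: s sw sep => [|x s IH] sw sep.
  by rewrite mul0r.
have -> : \bigcup_(y in [set` x :: s]) ball y rho =
    ball x rho `|` \bigcup_(y in [set` s]) ball y rho.
  apply/seteqP; split => [z [y /=]|z [xz|[y /= ys yz]]].
  - by rewrite inE => /orP[/eqP->|ys] yz; [left|right; exists y].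
  - by exists x => //=; rewrite mem_head.
  - by exists y => //=; rewrite inE ys orbT.
move: sep; rewrite /spaced /= => /andP[/allP xs sep].
rewrite measureU; first last.
- rewrite -subset0 => z /= -[+ [y /= ys]].
  rewrite -!ball_normE /= => xz yz.
  have := xs _ ys; apply/negP; rewrite -ltNge.
  rewrite (_ : x - y = (x - z) - (y - z)); last by ring.
  apply: (le_lt_trans (ler_normB _ _)); lra.
- apply: fin_bigcup_measurable; first exact: finite_seq.
  by move=> y _; exact: measurable_realfun.measurable_ball.
- exact: measurable_realfun.measurable_ball.
rewrite -addn1 natrD mulrDl mul1r addrC EFinD; apply: leeD.
  by apply: sw; rewrite mem_head.
apply: IH => // y ys; apply: sw; by rewrite inE ys orbT.
Qed.

(** A bound on the lengths yields a longest spaced list. A point of [A] at distance at least [t]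
    from all its members could be added, so the list is also a net at the same scale. *)
Lemma ex_maximal_spaced (R : realType) (A : set R) (t : R) (n : nat) :
  (forall s : seq R, {in s, forall x, A x} -> spaced t s -> (size s <= n)%N) ->
  exists s : seq R, [/\ {in s, forall x, A x}, spaced t s &
    forall x, A x -> exists2 y, y \in s & `|x - y| < t].
Proof.
move=> bnd.
pose P k := `[< exists s : seq R, [/\ {in s, forall x, A x}, spaced t s & size s = k] >].
have Pb k : P k -> (k <= n)%N by move=> /asboolP[s [sA ss <-]]; exact: bnd.
have exP : exists k, P k by exists 0%N; apply/asboolP; exists [::].
case: (ex_maxnP exP Pb) => k /asboolP[s [sA ss sk]] kmax.
exists s; split=> // x Ax; apply: contrapT => nx.
have : P k.+1.
  apply/asboolP; exists (x :: s); split => /=.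
  - by move=> y; rewrite inE => /orP[/eqP->//|/sA].
  - apply/andP; split; last exact: ss.
    apply/allP => y ys.
    by rewrite leNgt; apply/negP => xy; apply: nx; exists y.
  - by rewrite sk.
by move/kmax; rewrite ltnn.
Qed.

(** For [delta <= 0] and r <= 1 one has r^delta >= 1, so all small balls about a point of [Om] have
    mass at least [a]. They shrink to a point of mass zero, which contradicts continuity from above
    for a finite measure. *)
Lemma condA_exponent_gt0 (R : realType) (mu : {measure set R -> \bar R})
    (Om : set R) (delta : R) :
  non_atomic mu -> finite_meas mu -> condA mu Om delta -> Om !=set0 -> 0 < delta.
Proof.
move=> na fm [r0 [a [b [r00 a0 a1 b1 A]]]] [c Oc].
rewrite ltNge; apply/negP => d0.
(* The radii must stay below [r0] for condition (A) and below 1 for r^delta >= 1. *)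
pose F n := ball c (Num.min r0 1 / n.+1%:R).
have m1 : 0 < Num.min r0 1 by rewrite lt_min r00 ltr01.
have mF n : measurable (F n) by exact: measurable_realfun.measurable_ball.
have F1 : \bigcap_n F n = [set c].
  apply/seteqP; split => [x Fx|x -> n _]; last first.
    by apply: ballxx; rewrite divr_gt0.
  apply: contrapT => /= /eqP xc.
  have : 0 < `|c - x| by rewrite normr_gt0 subr_eq0 eq_sym.
  move=> h; pose n := Num.truncn (Num.min r0 1 / `|c - x|).
  have := Fx n I; rewrite /F -ball_normE /=; apply/negP; rewrite -leNgt.
  rewrite ler_pdivrMr // mulrC -ler_pdivrMr //.
  by apply/ltW/truncnS_gt.
have : mu \o F @ \oo --> mu (\bigcap_n F n).
  apply: nonincreasing_cvg_mu.
  - apply: le_lt_trans fm; apply: le_measure; rewrite ?inE //.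
  - exact: mF.
  - by rewrite F1; exact: measurable_set1.
  - move=> m n mn; apply/subsetPset; apply: le_ball.
    by rewrite ler_pM2l // lef_pV2 ?posrE // ler_nat.
rewrite F1 na => cv.
have : (a%:E <= 0)%E.
  have <- := cvg_lim (@ereal_hausdorff _) cv.
  apply: lime_ge; first by apply/cvg_ex; eexists; exact: cv.
  near=> n; rewrite /=.
  have e0 : 0 < Num.min r0 1 / n.+1%:R by rewrite divr_gt0.
  have e1 : Num.min r0 1 / n.+1%:R <= Num.min r0 1.
    rewrite ler_pdivrMr //; apply: ler_peMr; [exact: ltW|by rewrite ler1n].
  have [|h _] := A c (Num.min r0 1 / n.+1%:R) Oc e0.
    by apply: le_trans e1 _; rewrite ge_min lexx.
  apply: le_trans h; rewrite lee_fin; apply: ler_peMr; first exact: ltW.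
  apply: (@le_trans _ _ ((Num.min r0 1 / n.+1%:R) `^ 0)); first by rewrite powRr0.
  apply: ger_powR => //; rewrite e0 /=.
  by apply: le_trans e1 _; rewrite ge_min lexx orbT.
by rewrite lee_fin leNgt a0.
Unshelve. all: by end_near.
Qed.

Lemma powR_div (R : realType) (x y r : R) :
  0 <= x -> 0 < y -> (x / y) `^ r = x `^ r / y `^ r.
Proof.
move=> x0 y0; have p0 : y `^ r != 0 by rewrite gt_eqF // powR_gt0.
apply: (mulIf p0); rewrite divfK // -powRM ?divfK ?gt_eqF // //; first by rewrite divr_ge0 // ltW.
exact: ltW.
Qed.

Lemma measure_bigcup_seq_le (R : realType) (d : measure_display)
    (V : measurableType d) (mu : {measure set V -> \bar R})
    (T : eqType) (F : T -> set V) (w : R) (s : seq T) :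
  (forall x, measurable (F x)) -> (forall x, x \in s -> (mu (F x) <= w%:E)%E) ->
  (mu (\bigcup_(x in [set` s]) F x) <= ((size s)%:R * w)%:E)%E.
Proof.
move=> mF; have mU (s' : seq T) : measurable (\bigcup_(y in [set` s']) F y).
  by apply: fin_bigcup_measurable; first exact: finite_seq.
elim: s => [|x s IH] sw.
  by rewrite mul0r (_ : bigcup _ _ = set0) ?measure0 // -subset0 => z [y].
have -> : \bigcup_(y in [set` x :: s]) F y = F x `|` \bigcup_(y in [set` s]) F y.
  apply/seteqP; split => [z [y /=]|z [xz|[y /= ys yz]]].
  - by rewrite inE => /orP[/eqP->|ys] yz; [left|right; exists y].
  - by exists x => //=; rewrite mem_head.
  - by exists y => //=; rewrite inE ys orbT.
apply: (@le_trans _ _ (mu (F x) + mu (\bigcup_(y in [set` s]) F y))%E).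
  by apply: measureU2.
rewrite /= -add1n natrD mulrDl mul1r EFinD; apply: leeD.
  by apply: sw; rewrite mem_head.
by apply: IH => y ys; apply: sw; rewrite inE ys orbT.
Qed.

Section AhlforsRegular.
Variables (R : realType) (mu : {measure set R -> \bar R}) (Om : set R).
Variables (r0 a b delta : R).
Hypotheses (a0 : 0 < a) (b0 : 0 < b).
Hypothesis Omc : compact Om.
Hypothesis supp : supported_on mu Om.
Hypothesis fin : finite_meas mu.
Hypothesis regular : forall c r : R, Om c -> 0 < r -> r <= r0 ->
  ((a * r `^ delta)%:E <= mu (ball c r))%E /\
  (mu (ball c r) <= (b * r `^ delta)%:E)%E.

(** Mass comparison inside one large ball. Since [z] may lie off [Om], the large ball is centred at
    a listed point [c]: all points are within 2D of it and [t / 2 <= D], whence the radius 3D. *)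
Lemma spaced_card_le (s : seq R) (z D t : R) :
  {in s, forall x, Om x} -> {in s, forall x, `|x - z| <= D} ->
  0 < t -> t <= 2 * D -> 3 * D <= r0 -> spaced t s ->
  (size s)%:R <= b / a * (6 * D / t) `^ delta.
Proof.
move=> sO sD t0 tD Dr ss.
have D0 : 0 < D by lra.
case: s sO sD ss => [|c s] sO sD ss.
  by rewrite mulr_ge0 ?powR_ge0 // ltW // divr_gt0.
have cs : c \in c :: s by rewrite mem_head.
have Oc := sO _ cs; have cD := sD _ cs.
have t20 : 0 < t / 2 by lra.
have D30 : 0 < 3 * D by lra.
have := @spaced_measure_le _ mu (t / 2) (a * (t / 2) `^ delta) (c :: s)
  (ball c (3 * D)) t20 (measurable_realfun.measurable_ball _ _).
have -> : 2 * (t / 2) = t by field.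
have [_ up] := regular Oc D30 Dr.
move=> /(_ _ _ ss) h.
have : (((size (c :: s))%:R * (a * (t / 2) `^ delta))%:E <= (b * (3 * D) `^ delta)%:E)%E.
  apply: le_trans up; apply: h => x xs.
    move=> y; rewrite -!ball_normE /= => xy.
    have xD := sD _ xs.
    have -> : c - y = (c - z) - (x - z) + (x - y) by ring.
    apply: le_lt_trans (ler_normD _ _) _.
    have := ler_normB (c - z) (x - z); lra.
  have [] := @regular x (t / 2) (sO _ xs) t20; last by [].
  lra.
rewrite lee_fin => {}h.
have -> : 6 * D / t = (3 * D) / (t / 2) by field; lra.
have p0 : 0 < (t / 2) `^ delta by rewrite powR_gt0.
rewrite powR_div ?(ltW D30) // -(ler_pM2r a0) -(ler_pM2r p0) -mulrA.
by apply: le_trans h _; rewrite le_eqVlt; apply/orP; left; apply/eqP; field; rewrite !gt_eqF.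
Qed.

Lemma local_net (z D t : R) :
  0 < t -> t <= 2 * D -> 3 * D <= r0 ->
  exists s : seq R, (size s)%:R <= b / a * (6 * D / t) `^ delta /\
    forall x, Om x -> `|x - z| <= D -> exists2 y, y \in s & `|x - y| < t.
Proof.
move=> t0 tD Dr.
have := @ex_maximal_spaced R [set x | Om x /\ `|x - z| <= D] t
   (Num.truncn (b / a * (6 * D / t) `^ delta)).
have B0 : 0 <= b / a * (6 * D / t) `^ delta.
  by rewrite mulr_ge0 ?powR_ge0 // ltW // divr_gt0.
case=> [s sA ss|s [sA ss net]].
  by rewrite truncn_ge_nat //; apply: (@spaced_card_le s z) => // x /sA[].
exists s; split; first by apply: (@spaced_card_le s z) => // x /sA[].
by move=> x Ox xz; apply: net.
Qed.

(** The packing argument again, with the total mass in the role of the mass of a large ball. *)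
Lemma global_net : exists2 C : R, 0 <= C & forall t, 0 < t -> t <= r0 ->
  exists s : seq R, (size s)%:R <= C * t `^ (- delta) /\
    forall x, Om x -> exists2 y, y \in s & `|x - y| < t.
Proof.
exists (fine (mu setT) / a * 2 `^ delta) => [|t t0 tr].
  by rewrite mulr_ge0 ?powR_ge0 // divr_ge0 ?fine_ge0 // ltW.
have muE : mu setT = (fine (mu setT))%:E.
  by rewrite fineK // ge0_fin_numE.
set B := _ * _.
have B0 : 0 <= B by rewrite !mulr_ge0 ?powR_ge0 ?invr_ge0 ?fine_ge0 // ltW.
have bnd s : {in s, forall x, Om x} -> spaced t s -> (size s)%:R <= B.
  move=> sO ss; have t20 : 0 < t / 2 by lra.
  have := @spaced_measure_le _ mu (t / 2) (a * (t / 2) `^ delta) s setT t20 measurableT.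
  have -> : 2 * (t / 2) = t by field.
  move=> /(_ _ _ ss); rewrite muE lee_fin => h.
  have {}h : (size s)%:R * (a * (t / 2) `^ delta) <= fine (mu setT).
    apply: h => // x xs; have [] := @regular x (t / 2) (sO _ xs) t20; last by [].
    lra.
  have p0 : 0 < (t / 2) `^ delta by rewrite powR_gt0.
  have p1 : 0 < t `^ delta by rewrite powR_gt0.
  have p2 : 0 < (2 : R) `^ delta by rewrite powR_gt0.
  have E : t `^ delta = 2 `^ delta * (t / 2) `^ delta.
    by rewrite -powRM ?ltW // mulrC divfK.
  rewrite /B powRN E -(ler_pM2r a0) -(ler_pM2r p0) -mulrA.
  by apply: le_trans h _; rewrite le_eqVlt; apply/orP; left; apply/eqP; field; rewrite !gt_eqF.
have [s sA ss|s [sA ss net]] := @ex_maximal_spaced R Om t (Num.truncn B).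
  by rewrite truncn_ge_nat //; apply: bnd.
by exists s; split; [exact: bnd|].
Qed.

Lemma ex_spaced (c D t : R) :
  Om c -> 0 < t -> t <= D -> 3 * D <= r0 ->
  exists s : seq R, [/\ {in s, forall x, Om x}, {in s, forall x, `|x - c| <= D},
    spaced t s & a / b * (D / t) `^ delta <= (size s)%:R].
Proof.
move=> Oc t0 tD Dr.
have D0 : 0 < D by lra.
have mO : measurable Om.
  apply: measurable_realfun.closed_measurable.
  exact: compact_closed.
have := @ex_maximal_spaced R [set x | Om x /\ `|x - c| <= D] t
   (Num.truncn (b / a * (6 * D / t) `^ delta)).
have B0 : 0 <= b / a * (6 * D / t) `^ delta.
  by rewrite mulr_ge0 ?powR_ge0 // ltW // divr_gt0.
case=> [s sA ss|s [sA ss net]].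
  by rewrite truncn_ge_nat //; apply: (@spaced_card_le s c) => // [x /sA[]//|x /sA[]//|]; lra.
exists s; split => // [x /sA[]//|x /sA[]//|].
have [lo _] : _ /\ _ := @regular c D Oc D0 ltac:(lra).
have : (mu (ball c D) <= ((size s)%:R * (b * t `^ delta))%:E)%E.
  (* The net covers only points of [Om]; the rest of the ball lies in a null set. *)
  apply: (@le_trans _ _ (mu (~` Om `|` \bigcup_(y in [set` s]) ball y t))).
    apply: le_measure.
    - by rewrite inE; exact: measurable_realfun.measurable_ball.
    - rewrite inE; apply: measurableU; first exact: measurableC.
      apply: fin_bigcup_measurable; first exact: finite_seq.
      by move=> x _; exact: measurable_realfun.measurable_ball.
    - move=> x; rewrite -ball_normE /= => cx.
      have [Ox|nOx] := pselect (Om x); last by left.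
      right; have [|y ys] := net x.
        by split => //; rewrite distrC ltW.
      by rewrite distrC => xy; exists y.
  have mU : measurable (\bigcup_(y in [set` s]) ball y t).
    apply: fin_bigcup_measurable; first exact: finite_seq.
    by move=> x _; exact: measurable_realfun.measurable_ball.
  apply: (le_trans (measureU2 _ _ _)) => //; first exact: measurableC.
  have s0 : (mu (~` Om) <= 0)%E by rewrite supp.
  rewrite -[leRHS]add0e; apply: leeD; first exact: s0.
  apply: measure_bigcup_seq_le => x; first exact: measurable_realfun.measurable_ball.
  move=> xs.
  have [Ox _] := sA _ xs.
  have [] := @regular x t Ox t0; last by [].
  lra.
move=> up; have := le_trans lo up; rewrite lee_fin => {}h.
have p0 : 0 < t `^ delta by rewrite powR_gt0.
rewrite powR_div ?(ltW D0) // -(ler_pM2r b0) -(ler_pM2r p0).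
have -> : a / b * (D `^ delta / t `^ delta) * b * t `^ delta = a * D `^ delta.
  by field; rewrite !gt_eqF.
by rewrite -mulrA.
Qed.

End AhlforsRegular.

(** * The simplex lemma *)

(** Each of the n! terms of the Leibniz formula takes one entry from every column. This crude bound
    suffices because the factorial is absorbed by the choice of [rho0]. *)
Lemma det_le_cols (R : realType) n (A : 'M[R]_n) (b : 'I_n -> R) :
  (forall i j, `|A i j| <= b j) -> `|\det A| <= n`!%:R * \prod_j b j.
Proof.
move=> Ab; rewrite /determinant.
apply: le_trans (ler_norm_sum _ _ _) _.
rewrite -card_Sn mulr_natl -sumr_const.
apply: ler_sum => s _; rewrite normrM normrX normrN1 expr1n mul1r normr_prod.
rewrite [leRHS](reindex_inj (@perm_inj _ s)) /=.
by apply: ler_prod => j _; rewrite normr_ge0 Ab.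
Qed.

(** Independent rows are collected greedily from [S]; the process can stop early only at a common
    annihilator. *)
Lemma annihilated_or_basis (F : fieldType) n (S : set 'rV[F]_n) :
  (exists2 h : 'cV[F]_n, h != 0 & forall v, S v -> v *m h = 0) \/
  (exists2 A : 'M[F]_n, forall i, S (row i A) & \det A != 0).
Proof.
have [|noh] := pselect (exists2 h : 'cV[F]_n, h != 0 & forall v, S v -> v *m h = 0).
  by left.
right.
suff K k : (k <= n)%N -> exists2 A : 'M[F]_(k, n), forall i, S (row i A) & row_free A.
  have [A AS Af] := K n (leqnn n).
  by exists A => //; move: Af; rewrite row_free_unit unitmxE unitfE.
elim: k => [_|k IH kn].
  exists (0 : 'M[F]_(0, n)); first by case.
  by rewrite /row_free mxrank0.
have [A AS Af] := IH (ltnW kn).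
(* Fewer than [n] rows leave a nonzero cokernel, any nonzero column of which annihilates the rows
   found so far. A member of [S] that it does not annihilate is independent of them. *)
have [j cj] : exists j, col j (cokermx A) != 0.
  apply: contrapT => nj.
  have : cokermx A = 0.
    apply/matrixP => x y; rewrite [RHS]mxE; apply: contrapT => xy; apply: nj; exists y.
    by apply/eqP => /matrixP/(_ x 0); rewrite mxE [RHS]mxE.
  move/(congr1 (fun M => \rank M)); rewrite mxrank_coker mxrank0.
  by move: Af; rewrite /row_free => /eqP ->; move/eqP; rewrite subn_eq0 leqNgt kn.
set h := col j (cokermx A) in cj.
have Ah : A *m h = 0 by rewrite /h colE mulmxA mulmx_coker mul0mx.
have [v Sv vh] : exists2 v, S v & v *m h != 0.
  apply: contrapT => nv; apply: noh; exists h => // v Sv; apply: contrapT => /eqP vh.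
  by apply: nv; exists v.
have BS (i : 'I_(1 + k)) : S (row i (col_mx v A)).
  case: (split_ordP i) => l ->; last by rewrite rowKd.
  by rewrite rowKu row_id.
have Bf (u : 'rV_(1 + k)) : u *m col_mx v A = 0 -> u = 0.
  rewrite -[u]hsubmxK mul_row_col => E.
  have u1 : lsubmx u = 0.
    have : (lsubmx u *m v + rsubmx u *m A) *m h = 0 by rewrite E mul0mx.
    rewrite mulmxDl -!mulmxA Ah mulmx0 addr0.
    rewrite [lsubmx u]mx11_scalar [v *m h]mx11_scalar -scalar_mxM => /matrixP/(_ 0 0).
    rewrite !mxE /= mulr1n => /eqP; rewrite mulf_eq0 => /orP[/eqP z|/eqP z].
      by apply/matrixP => x y; rewrite !ord1 !mxE z mul0rn.
    by move: vh => /negP; case; apply/eqP/matrixP => x y; rewrite !ord1 !mxE z.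
  move: E; rewrite u1 mul0mx add0r => E.
  have -> : rsubmx u = 0 by apply: (row_free_inj Af); rewrite E mul0mx.
  by rewrite row_mx0.
exists (col_mx v A : 'M[F]_(1 + k, n)); first exact: BS.
by apply: inj_row_free => u; exact: Bf.
Qed.

Lemma unit_det_int (R : realType) n (A : 'M[R]_n) :
  (forall i j, exists z : int, A i j = z%:~R) -> \det A != 0 -> 1 <= `|\det A|.
Proof.
move=> /(_ _)/choice Az.
have /choice[f fA] : forall i, exists g : 'I_n -> int, forall j, A i j = (g j)%:~R.
  by move=> i; have [g gA] := Az i; exists g.
have -> : A = map_mx intr (\matrix_(i, j) f i j).
  by apply/matrixP => i j; rewrite !mxE fA.
rewrite det_map_mx intr_eq0 -intr_norm -[1]/(1%:~R) ler_int => d0.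
by rewrite -gtz0_ge1 normr_gt0.
Qed.

(* Coordinates outside [J] carry no condition: the unit vectors along them are
   added to the rows, which forces the coefficients of [h] there to vanish, and
   their columns are bounded by 1. *)
Lemma simplex (R : realType) N (J : pred 'I_N) (x0 w : 'I_N -> R) (Q : R) (j : 'I_N) :
  J j -> 0 <= Q -> (forall r, 0 <= w r) ->
  (N.+1)`!%:R * (Q * \prod_(r | J r) w r) < 1 ->
  exists h0 : R, exists h : 'I_N -> R,
    [/\ exists2 r, J r & h r != 0, forall r, ~~ J r -> h r = 0 &
     forall (q : nat) (p : 'I_N -> int), (0 < q)%N -> q%:R <= Q ->
       (forall r, J r -> `|(p r)%:~R - q%:R * x0 r| <= w r) ->
       h0 * q%:R + \sum_r h r * (p r)%:~R = 0].
Proof.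
move=> Jj Q0 w0 small.
(* Homogeneous coordinates (q, p_1, ..., p_N), which make the determinant integral. *)
pose mk (q : int) (p : 'I_N -> int) : 'rV[R]_N.+1 :=
  \row_i (if unlift ord0 i is Some r then (p r)%:~R else q%:~R).
have mk0 q p : mk q p 0 ord0 = q%:~R by rewrite mxE unlift_none.
have mkS q p r : mk q p 0 (lift ord0 r) = (p r)%:~R by rewrite mxE liftK.
pose pnt (v : 'rV[R]_N.+1) := exists (q : nat) (p : 'I_N -> int),
  [/\ q%:R <= Q, forall r, J r -> `|(p r)%:~R - q%:R * x0 r| <= w r,
      forall r, ~~ J r -> p r = 0 & v = mk q p].
pose aux (v : 'rV[R]_N.+1) := exists2 s, ~~ J s & v = mk 0 (fun r => (r == s)%:Z).
case: (@annihilated_or_basis R N.+1 [set v | pnt v \/ aux v]) => [[h h0 hS]|[A AS dA]].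
  have hJ r : ~~ J r -> h (lift ord0 r) 0 = 0.
    move=> nJ; have /hS : pnt (mk 0 (fun s => (s == r)%:Z)) \/ aux (mk 0 (fun s => (s == r)%:Z)).
      by right; exists r.
    move/matrixP/(_ 0 0); rewrite mxE big_ord_recl mk0 mul0r add0r.
    rewrite (bigD1 r) //= mkS eqxx mul1r big1 ?addr0 ?mxE // => s sr.
    by rewrite mkS (negbTE sr) mul0r.
  have hp (q : nat) (p : 'I_N -> int) : (0 < q)%N -> q%:R <= Q ->
      (forall r, J r -> `|(p r)%:~R - q%:R * x0 r| <= w r) ->
      h ord0 0 * q%:R + \sum_r h (lift ord0 r) 0 * (p r)%:~R = 0.
    (* Clearing the coordinates outside [J] brings the point into [pnt] and does not change the
       equation, as [h] vanishes there. *)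
    move=> q0 qQ pw; pose p' r := if J r then p r else 0.
    have /hS : pnt (mk q p') \/ aux (mk q p').
      left; exists q, p'; split=> // r; rewrite /p'.
        by move=> Jr; rewrite Jr; exact: pw.
      by move/negbTE ->.
    move/matrixP/(_ 0 0); rewrite mxE big_ord_recl mk0 mxE mulrC => E; rewrite -[RHS]E.
    congr (_ + _); apply: eq_bigr => r _; rewrite mkS mulrC /p'.
    by case: ifPn => // /hJ ->; rewrite !mulr0 .
  have [[r hr]|nr] := pselect (exists r, h (lift ord0 r) 0 != 0).
    exists (h ord0 0), (fun r => h (lift ord0 r) 0); split => //.
    by exists r => //; apply: contraT => /hJ /eqP; rewrite (negbTE hr).
  have hz r : h (lift ord0 r) 0 = 0 by apply: contrapT => /eqP hr; apply: nr; exists r.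
  (* If only the constant coefficient survives, the equation reads h_0 q = 0. Hence no point
     satisfies the bounds, and any hyperplane with a nonzero coefficient in [J] will do. *)
  exists 0, (fun r => (r == j)%:R); split.
  - by exists j => //; rewrite eqxx oner_eq0.
  - by move=> r; case: eqP => // ->; rewrite Jj.
  - move=> q p q0 qQ pw; exfalso; have := hp q p q0 qQ pw.
    rewrite big1 ?addr0 => [/eqP|r _]; last by rewrite hz mul0r.
    rewrite mulf_eq0 pnatr_eq0 -leqn0 leqNgt q0 orbF => /eqP h00.
    move: h0 => /negP; apply; apply/eqP/matrixP => i k; rewrite ord1 [RHS]mxE.
    by case: (unliftP ord0 i) => [r ->|->].
exfalso.
have Aint i k : exists z : int, A i k = z%:~R.
  have -> : A i k = row i A 0 k by rewrite mxE.
  case: (AS i) => [[q [p [_ _ _ ->]]]|[s _ ->]]; rewrite mxE;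
    by case: (unlift ord0 k) => [r|]; eexists.
have := unit_det_int Aint dA; rewrite leNgt => /negP; apply.
(* Multiplying by the unitriangular [T] subtracts [y r] times the first column from the column of
   [r]. This turns p_r into p_r - q x0_r and keeps the determinant. *)
pose y r := if J r then x0 r else 0.
pose T : 'M[R]_N.+1 := \matrix_(i, k)
  ((i == k)%:R - (if unlift ord0 k is Some r then (i == ord0)%:R * y r else 0)).
have dT : \det T = 1.
  rewrite -det_tr det_trig.
    apply: big1 => i _; rewrite !mxE eqxx; case: unliftP => [r ->|_]; last by rewrite subr0.
    by rewrite eq_sym (negbTE (neq_lift _ _)) mul0r subr0.
  apply/is_trig_mxP => i k ik; rewrite !mxE.
  have -> : (k == i) = false by apply/negbTE; rewrite neq_ltn ik orbT.
  case: unliftP => [r _|_]; last by rewrite subr0.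
  have -> : (k == ord0) = false by apply/negbTE; rewrite -val_eqE /= -lt0n; apply: leq_ltn_trans ik.
  by rewrite mul0r subr0.
pose b k := if unlift ord0 k is Some r then (if J r then w r else 1) else Q.
apply: le_lt_trans small.
have -> : Q * \prod_(r | J r) w r = \prod_k b k.
  rewrite big_ord_recl /b unlift_none; congr (_ * _).
  by rewrite big_mkcond; apply: eq_bigr => r _; rewrite liftK.
have -> : \det A = \det (A *m T) by rewrite det_mulmx dT mulr1.
apply: det_le_cols => i k.
have -> : (A *m T) i k = row i A 0 k -
    (if unlift ord0 k is Some r then row i A 0 ord0 * y r else 0).
  rewrite mxE (eq_bigr (fun l => A i l * (l == k)%:R -
     A i l * (if unlift ord0 k is Some r then (l == ord0)%:R * y r else 0))); last first.
    by move=> l _; rewrite mxE mulrBr.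
  rewrite big_split /= sumrN; congr (_ - _).
    rewrite (bigD1 k) //= eqxx mulr1 big1 ?addr0 ?mxE // => l /negbTE ->.
    by rewrite mulr0.
  case: unlift => [r|]; last by rewrite big1 // => l _; rewrite mulr0.
  rewrite (bigD1 ord0) // eqxx mul1r big1 /=; first by rewrite addr0 mxE.
  by move=> l /negbTE ->; rewrite mul0r mulr0.
rewrite /b; case: unliftP => [r ->|->]; last first.
  rewrite subr0; case: (AS i) => [[q [p [qQ _ _ ->]]]|[s _ ->]]; rewrite mk0 ?normr0 //.
  by rewrite ger0_norm ?ler0n.
case: (AS i) => [[q [p [qQ pw pJ ->]]]|[s sJ ->]]; rewrite mk0 mkS /y; case: ifPn => Jr.
- exact: pw.
- by rewrite pJ // mulr0 subr0 normr0.
- rewrite mul0r subr0; case: eqP => [rs|]; first by rewrite -rs Jr in sJ.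
  by rewrite normr0.
- by rewrite mulr0 subr0; case: eqP; rewrite ?normr1 ?normr0.
Qed.

(** * Counting in products *)

Lemma prod_powR (R : realType) N (x : R) (d : 'I_N -> R) : 0 < x ->
  \prod_r x `^ (d r) = x `^ (\sum_r d r).
Proof.
move=> x0; apply/esym/(big_morph (fun y => x `^ y)); last by rewrite powRr0.
by move=> y z; rewrite /= powRD //; apply/implyP => _; rewrite gt_eqF.
Qed.

(** Grids with different numbers of points per coordinate are coded in one finite function type with
    the common codomain ['I_B]. *)
Lemma card_family_ltn N B (m : 'I_N -> nat) : (forall r, (m r <= B)%N) ->
  #|family (fun r : 'I_N => [pred x : 'I_B | (x < m r)%N])| = (\prod_r m r)%N.
Proof.
move=> mB; rewrite card_family foldrE big_map big_enum /=.
apply: eq_bigr => r _; rewrite -[RHS](card_ord (m r)).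
rewrite -(card_codom (f := widen_ord (mB r))) => [|x y /(congr1 val) /= /val_inj //].
apply: eq_card => x; apply/idP/codomP => [xm|[y ->]]; last exact: (ltn_ord y).
by exists (Ordinal (xm : (x < m r)%N)); apply: val_inj.
Qed.

(** Erasing coordinate [s] maps [D] into a grid of size the product of the other [m r], with fibres
    of at most [C] elements. The codomain ['I_B.+1] provides [ord0] as the erased value. *)
Lemma card_le_fibers N B (m : 'I_N -> nat) (s : 'I_N) (C : nat)
    (D : {set {ffun 'I_N -> 'I_B.+1}}) :
  (forall r, (m r <= B.+1)%N) -> (0 < m s)%N ->
  (forall f, f \in D -> forall r, (f r < m r)%N) ->
  (forall g, g \in D ->
     (#|[set f in D | [forall r, (r != s) ==> (f r == g r)]]| <= C)%N) ->
  (#|D| * m s <= C * \prod_r m r)%N.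
Proof.
move=> mB ms Dm DC.
pose phi (f : {ffun 'I_N -> 'I_B.+1}) := [ffun r => if r == s then ord0 else f r].
have -> : (\prod_r m r = m s * \prod_r (if r == s then 1 else m r))%N.
  rewrite (bigD1 s) //= [in RHS](bigD1 s) //= eqxx mul1n; congr (_ * _)%N.
  by apply: eq_bigr => r /negbTE ->.
rewrite mulnA mulnAC leq_pmul2r // -sum1_card (partition_big_imset phi) /=.
apply: (@leq_trans (\sum_(j in phi @: D) C)).
  apply: leq_sum => _ /imsetP[g gD ->]; rewrite sum1dep_card.
  apply: leq_trans (DC g gD); apply/subset_leq_card/fintype.subsetP => f.
  rewrite !inE => /andP[-> /eqP/ffunP fg] /=; apply/forallP => r; apply/implyP => rs.
  by have := fg r; rewrite !ffunE (negbTE rs) => ->.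
rewrite sum_nat_const mulnC leq_mul2l; apply/orP; right.
rewrite -(@card_family_ltn N B.+1); last by move=> r; case: eqP.
apply/subset_leq_card/fintype.subsetP => _ /imsetP[g gD ->].
apply/familyP => r; rewrite ffunE inE; case: eqP => [//|_].
exact: Dm.
Qed.

(** After division by [t] the points are at distance at least 1, so their integer parts in an
    interval of length [2 * w / t] are distinct. *)
Lemma card_spaced_near (R : realType) B m (X : nat -> R) (t z w : R) :
  0 < t ->
  (forall u u', (u < m)%N -> (u' < m)%N -> u != u' -> t <= `|X u - X u'|) ->
  (#|[set u : 'I_B | (u < m)%N && (`|X u - z| <= w)%R]%SET| <= (Num.truncn (2 * w / t)).+1)%N.
Proof.
move=> t0 sp; set A := (X in #|X|).
pose y (u : 'I_B) := (X u - (z - w)) / t.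
have yb u : u \in A -> 0 <= y u <= 2 * w / t.
  rewrite inE => /andP[_]; rewrite ler_norml => /andP[h1 h2]; apply/andP; split.
    by apply: divr_ge0; [lra|exact: ltW].
  by rewrite /y ler_pM2r ?invr_gt0 //; lra.
rewrite -[leqRHS]card_ord.
apply: (@leq_card_in _ _ (fun u => inord (Num.truncn (y u)))).
move=> u v uA vA /(congr1 val) /=.
have lt x : x \in A -> (Num.truncn (y x) < (Num.truncn (2 * w / t)).+1)%N.
  by move=> /yb /andP[_ h]; rewrite ltnS; exact: le_truncn.
rewrite !inordK ?lt // => E.
apply: contrapT => uv; move: (uA) (vA); rewrite !inE => /andP[um _] /andP[vm _].
have /eqP/sp := fun e : val u = val v => uv (val_inj e).
move=> /(_ um vm); apply/negP; rewrite -ltNge.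
have /andP[y0 _] := yb _ uA; have /andP[y0' _] := yb _ vA.
have := truncn_itv y0; have := truncn_itv y0'; rewrite E => /andP[v1 v2] /andP[u1 u2].
have -> : X u - X v = (y u - y v) * t by rewrite /y; field; rewrite gt_eqF.
rewrite normrM (gtr0_norm t0) -[ltRHS]mul1r ltr_pM2r // ltr_norml.
move: u1 u2 v1 v2; rewrite -natr1; lra.
Qed.

(** The intervals of radius [w n] about [c n] are nested, since 1/2 + 1/4 <= 1; the supremum of
    their left ends lies in all of them. *)
Lemma nested_limit (R : realType) (c w : nat -> R) :
  (forall n, 0 < w n) -> (forall n, w n.+1 * 4 <= w n) ->
  (forall n, `|c n.+1 - c n| <= w n / 2) -> exists x, forall n, `|x - c n| <= w n.
Proof.
move=> w0 wS cS.
have cmn a d : `|c (a + d)%N - c a| <= w a - w (a + d)%N.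
  elim: d => [|d IH]; first by rewrite addn0 !subrr normr0.
  rewrite addnS; have := cS (a + d)%N; have := wS (a + d)%N; have := w0 (a + d)%N.
  have := ler_normD (c (a + d).+1 - c (a + d)%N) (c (a + d)%N - c a).
  rewrite subrKA; lra.
have lo a b : c a - w a <= c b + w b.
  have [ab|/ltnW ab] := leqP a b.
    have := cmn a (b - a)%N; rewrite subnKC // => /ler_normlW h.
    have := cmn a (b - a)%N; rewrite subnKC // distrC => /ler_normlW h'.
    have := w0 b; lra.
  have := cmn b (a - b)%N; rewrite subnKC // => /ler_normlW h.
  have := w0 a; lra.
pose S := [set c n - w n | n in [set: nat]].
have hS : has_sup S.
  split; first by exists (c 0%N - w 0%N), 0%N.
  by exists (c 0%N + w 0%N) => _ [a _ <-]; exact: lo.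
exists (sup S) => n; rewrite ler_norml; apply/andP; split.
  by have := sup_upper_bound hS; move=> /(_ (c n - w n)) h; have := h (ex_intro2 _ _ n I erefl); lra.
have : sup S <= c n + w n by apply: ge_sup; [case: hS|move=> _ [a _ <-]; exact: lo].
lra.
Qed.

Lemma dist_nearest_intE (R : realType) (y : R) : exists p : int, dist_nearest_int y = `|y - p%:~R|.
Proof.
rewrite /dist_nearest_int; case: leP => _.
  by exists (Num.floor y); rewrite ger0_norm // subr_ge0 floor_le.
by exists (Num.ceil y); rewrite distrC ger0_norm // subr_ge0 ceil_ge.
Qed.

Lemma ex_positive_lower_bound (R : realType) N (f : 'I_N -> R) : (forall r, 0 < f r) ->
  exists2 c, 0 < c & forall r, c <= f r.
Proof.
move=> f0; exists (\big[Num.min/1]_r f r); last by move=> r; exact: bigmin_le.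
by apply/bigmin_gtP.
Qed.

(** * The Cantor construction *)

Section Cantor.
Variables (R : realType) (N : nat) (Om : 'I_N -> set R) (i : 'I_N -> R).
Variables (k : nat) (rho0 : R) (m : 'I_N -> nat).
Hypotheses (i0 : forall r, 0 <= i r) (i1 : \sum_(r < N) i r = 1).
Hypothesis k4 : (4 <= k)%N.
Hypothesis rho00 : 0 < rho0.
Hypothesis rho0_small : (N.+1)`!%:R * (2 * k%:R ^+ 2 * rho0) < 1.
Hypothesis m_large : forall r, (2 * (2 * N + 1) <= m r)%N.

Definition rate (r : 'I_N) : R := k%:R * k%:R `^ (i r).
Definition rho (n : nat) (r : 'I_N) : R := rho0 / rate r ^+ n.

(** Children are taken in the inner half of the parent so that their boxes lie inside it; with
    spacing 3 times the radius, the boxes of distinct children are disjoint. *)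
Hypothesis spaced_points : forall n r c, Om r c -> exists X : nat -> R,
  (forall u, (u < m r)%N -> Om r (X u) /\ `|X u - c| <= rho n r / 2) /\
  (forall u u', (u < m r)%N -> (u' < m r)%N -> u != u' ->
     3 * rho n.+1 r <= `|X u - X u'|).

(** The factor 2 leaves a margin: a limit point is within [rho n.+1 r] of the centre, so a centre
    that is not near a rational keeps the limit point more than [rho n.+1 r] away in some
    coordinate. *)
Definition near_rational n (c : 'I_N -> R) := exists (q : nat) (p : 'I_N -> int),
  [/\ (k ^ n <= q)%N, (q < k ^ n.+1)%N &
      forall r, 0 < i r -> `|c r - (p r)%:~R / q%:R| <= 2 * rho n.+1 r].

Lemma k_gt0 : 0 < k%:R :> R.
Proof. by rewrite ltr0n; lia. Qed.

Lemma rate_ge4 r : 4 <= rate r.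
Proof.
have k1 : 4 <= k%:R :> R by rewrite ler_nat.
have : 1 <= k%:R `^ i r :> R by rewrite -[leLHS](powRr0 k%:R); apply: ler_powR => //; lra.
rewrite /rate; nra.
Qed.

Lemma rho_gt0 n r : 0 < rho n r.
Proof. by rewrite divr_gt0 // exprn_gt0 //; have := rate_ge4 r; lra. Qed.

Lemma rhoS n r : rho n.+1 r * 4 <= rho n r.
Proof.
have h := rate_ge4 r.
have -> : rho n r = rho n.+1 r * rate r.
  rewrite /rho exprS; field; rewrite expf_neq0 gt_eqF //; lra.
by rewrite ler_pM2l // rho_gt0.
Qed.

Lemma prod_weights : \prod_(r | 0 < i r) k%:R `^ (i r) = k%:R :> R.
Proof.
have -> : \prod_(r | 0 < i r) k%:R `^ (i r) = \prod_r k%:R `^ (i r) :> R.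
  rewrite [LHS]big_mkcond; apply: eq_bigr => r _; case: ifPn => //.
  rewrite -leNgt => h; have -> : i r = 0 by apply/eqP; rewrite eq_le h i0.
  by rewrite powRr0.
by rewrite prod_powR ?k_gt0 // i1 powRr1 ?ler0n.
Qed.

Lemma ex_weight_gt0 : exists j, 0 < i j.
Proof.
apply: contrapT => nj; have := i1; rewrite big1 => [/eqP|r _].
  by rewrite eq_sym oner_eq0.
by apply/eqP; rewrite eq_le i0 andbT leNgt; apply/negP => h; apply: nj; exists r.
Qed.

(* Since the weights add up to 1, the powers of k^n in the product of the column
   bounds of [simplex] cancel, and rho0_small makes the product small for all n. *)
Lemma rational_hyperplane n (c : 'I_N -> R) : exists h0 : R, exists h : 'I_N -> R,
  [/\ exists r, h r != 0, forall r, ~~ (0 < i r) -> h r = 0 &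
    forall (q : nat) (p : 'I_N -> int), (0 < q)%N -> (q < k ^ n.+1)%N ->
      (forall r, 0 < i r -> `|c r - (p r)%:~R / q%:R| <= 2 * rho n r) ->
      h0 + \sum_r h r * ((p r)%:~R / q%:R) = 0].
Proof.
have [j ij] := ex_weight_gt0; have k0 := k_gt0.
(* Multiplying the bound [2 * rho n r] by q < k^(n+1) gives at most e / k^(n i_r). *)
pose e : R := 2 * k%:R * rho0.
have e0 : 0 < e by rewrite !mulr_gt0.
have rf : 1 <= (N.+1)`!%:R :> R by rewrite ler1n fact_gt0.
have k1 : 4 <= k%:R :> R by rewrite ler_nat.
have ke : (N.+1)`!%:R * (k%:R * e) < 1.
  by apply: le_lt_trans rho0_small; rewrite le_eqVlt; apply/orP; left; apply/eqP; rewrite /e; ring.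
have ke' : k%:R * e <= (N.+1)`!%:R * (k%:R * e) by rewrite ler_peMl // mulr_ge0 ?ltW.
have e1 : e <= 1 by nra.
pose v r : R := (k%:R `^ i r ^+ n)^-1.
have kr0 r : 0 < k%:R `^ i r :> R by rewrite powR_gt0.
have v0 r : 0 < v r by rewrite invr_gt0 exprn_gt0.
have [|r||h0 [h [[r ir hr] hJ H]]] := @simplex R N (fun r => 0 < i r) c (fun r => e * v r) (k%:R ^+ n.+1) j ij.
- by rewrite exprn_ge0 // ltW.
- by rewrite mulr_ge0 ?ltW.
- apply: le_lt_trans ke; rewrite ler_pM2l ?ltr0n ?fact_gt0 //.
  rewrite big_split /= prodfV prodrXl prod_weights exprS.
  set Pe := \prod_(_ < N | _) e.
  have -> : k%:R * k%:R ^+ n * (Pe / k%:R ^+ n) = k%:R * Pe.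
    by field; rewrite expf_neq0 // gt_eqF.
  (* One factor [e], that of [j], is kept; the others are at most 1. This is where a positive weight
     is needed. *)
  rewrite ler_pM2l // /Pe (bigD1 j) //= -[leRHS]mulr1 ler_pM2l //.
  by apply: numdomain.Num.Theory.prodr_ile1 => r _; rewrite e1 ltW.
exists h0, h; split => //; first by exists r.
move=> q p q0 qk pc.
have q0' : 0 < q%:R :> R by rewrite ltr0n.
have qk' : q%:R <= k%:R ^+ n.+1 :> R by rewrite -natrX ler_nat ltnW.
apply: (mulIf (lt0r_neq0 q0')); rewrite mul0r -[RHS](H q p q0 qk').
  rewrite mulrDl mulr_suml; congr (_ + _); apply: eq_bigr => s _.
  by rewrite -mulrA divfK // gt_eqF.
move=> s is0; have := pc s is0.
have -> : (p s)%:~R - q%:R * c s = - (c s - (p s)%:~R / q%:R) * q%:R.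
  by field; rewrite gt_eqF.
rewrite normrM normrN (gtr0_norm q0') => h1.
apply: le_trans (ler_pM _ _ h1 qk') _ => //.
rewrite le_eqVlt; apply/orP; left; apply/eqP.
rewrite /rho /rate /v /e exprMn exprS; field.
by rewrite !expf_neq0 // gt_eqF.
Qed.

(* Normalising the hyperplane by the coordinate [s] in which it is steepest
   relative to the sides of the child boxes, a child close to it is determined, up
   to 2N+1 choices, by its coordinates other than [s]. *)
Lemma children_exist n (c : 'I_N -> R) : (forall r, Om r (c r)) ->
  exists ch : nat -> 'I_N -> R,
  [/\ forall u, (u < uphalf (\prod_r m r))%N -> forall r,
        Om r (ch u r) /\ `|ch u r - c r| <= rho n r / 2,
      forall u, (u < uphalf (\prod_r m r))%N -> ~ near_rational n (ch u) &
      forall u u', (u < uphalf (\prod_r m r))%N -> (u' < uphalf (\prod_r m r))%N ->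
        u != u' -> exists r, 3 * rho n.+1 r <= `|ch u r - ch u' r|].
Proof.
move=> Oc; have [j ij] := ex_weight_gt0.
have /choice[X HX] : forall r, exists X : nat -> R,
  (forall u, (u < m r)%N -> Om r (X u) /\ `|X u - c r| <= rho n r / 2) /\
  (forall u u', (u < m r)%N -> (u' < m r)%N -> u != u' ->
     3 * rho n.+1 r <= `|X u - X u'|) by move=> r; exact: spaced_points.
pose B := (\sum_r m r)%N.
have mB r : (m r <= B.+1)%N by rewrite /B (bigD1 r) //=; lia.
pose pnt (f : {ffun 'I_N -> 'I_B.+1}) r := X r (f r).
pose Fam := [set f : {ffun 'I_N -> 'I_B.+1} | f \in family (fun r : 'I_N => [pred x : 'I_B.+1 | (x < m r)%N])]%SET.
have FamP f : f \in Fam -> forall r, (f r < m r)%N.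
  by rewrite inE => /familyP h r; have := h r; rewrite inE.
pose D := [set f in Fam | `[< near_rational n (pnt f) >]].
have DFam : D \subset Fam by apply/fintype.subsetP => f; rewrite inE => /andP[].
have cD : (2 * #|D| <= \prod_r m r)%N.
  have [h0 [h [[r0 hr0] hJ H]]] := rational_hyperplane n c.
  pose s := [arg max_(r > j) (`|h r| * rho n.+1 r)]%O.
  have smax r : `|h r| * rho n.+1 r <= `|h s| * rho n.+1 s.
    by rewrite /s; case: Order.TotalTheory.arg_maxP => // s' _; apply.
  have hs : 0 < `|h s|.
    rewrite normr_gt0; apply: contraTneq (smax r0) => ->.
    rewrite normr0 mul0r -ltNge mulr_gt0 ?normr_gt0 //; exact: rho_gt0.
  have hs' : h s != 0 by rewrite -normr_gt0.
  (* [m_large] makes 2N+1 at most half of [m s]. *)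
  suff : (#|D| * m s <= (2 * N + 1) * \prod_r m r)%N.
    by have := m_large s; move: (\prod_r m r)%N => P; nia.
  have rs0 := rho_gt0 n.+1 s.
  have ms0 : (0 < m s)%N by have := m_large s; lia.
  apply: card_le_fibers => // [f /(fintype.subsetP DFam)/FamP //|g gD].
  (* The [s]-coordinate of the point where the hyperplane meets the line through [pnt g] parallel to
     axis [s]. *)
  pose z := - (h0 + \sum_(r | r != s) h r * pnt g r) / h s.
  have [_ sps] := HX s.
  have t0 : 0 < 3 * rho n.+1 s by lra.
  (* Each of the N coordinates moves the point from the hyperplane by at most [2 * rho n.+1 s] in
     direction [s]. A window of radius 2N against spacing 3 holds at most floor(4N/3) + 1 <= 2N + 1
     points. *)
  apply: leq_trans (leq_trans (@card_spaced_near R B.+1 (m s) (X s) (3 * rho n.+1 s) z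
    (2 * N%:R * rho n.+1 s) t0 sps) _); last first.
    have -> : 2 * (2 * N%:R * rho n.+1 s) / (3 * rho n.+1 s) = 4 * N%:R / 3.
      by field; rewrite gt_eqF.
    have N0 : 0 <= N%:R :> R by rewrite ler0n.
    rewrite addn1 ltnS -(ler_nat R); apply: le_trans (_ : 4 * N%:R / 3 <= _).
      by rewrite truncn_le; lra.
    by rewrite natrM; lra.
  rewrite -(card_in_imset (f := fun f : {ffun 'I_N -> 'I_B.+1} => f s)); last first.
    move=> f f'; rewrite !inE => /andP[_ /forallP ff] /andP[_ /forallP ff'] e.
    apply/ffunP => r; have [->//|rs] := eqVneq r s.
    by have /eqP -> := implyP (ff r) rs; have /eqP -> := implyP (ff' r) rs.
  apply/subset_leq_card/fintype.subsetP => _ /imsetP[f + ->].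
  case/setIdP => fD /forallP fg; rewrite finset.in_set.
  rewrite (FamP f) ?(fintype.subsetP DFam) //=.
  have Fm := FamP f (fintype.subsetP DFam f fD).
  move: fD; rewrite inE => /andP[_ /asboolP[q [p [q1 q2 qp]]]].
  (* A rational near a child is near the parent: the distances [rho n r / 2] and
     [2 * rho n.+1 r <= rho n r / 2] add up to at most [rho n r]. One hyperplane therefore serves
     all children. *)
  have E : h0 + \sum_r h r * ((p r)%:~R / q%:R) = 0.
    apply: H => // [|r ir].
      by apply: leq_trans q1; rewrite expn_gt0 (ltn_trans _ k4).
    have [/(_ _ (Fm r))[_ h1] _] := HX r.
    have h2 := qp r ir; have h3 := rhoS n r.
    rewrite -/(pnt f r) in h1.
    have -> : c r - (p r)%:~R / q%:R = - (pnt f r - c r) + (pnt f r - (p r)%:~R / q%:R) by ring.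
    apply: le_trans (ler_normD _ _) _; rewrite normrN.
    have := rho_gt0 n r; lra.
  have zE : (X s (f s) - z) * h s = \sum_r h r * (pnt f r - (p r)%:~R / q%:R).
    have -> : \sum_r h r * (pnt f r - (p r)%:~R / q%:R) = h0 + \sum_r h r * pnt f r.
      rewrite -[RHS]subr0 -[X in _ = _ - X]E opprD addrACA subrr add0r -sumrB.
      by apply: eq_bigr => r _; rewrite mulrBr.
    rewrite (bigD1 s) //= /z mulrBl divfK // opprK mulrC.
    have -> : \sum_(r | r != s) h r * pnt g r = \sum_(r | r != s) h r * pnt f r.
      by apply: eq_bigr => r rs; rewrite /pnt; have /eqP -> := implyP (fg r) rs.
    by rewrite addrCA.
  rewrite -(ler_pM2r hs) -normrM zE.
  apply: le_trans (ler_norm_sum _ _ _) _.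
  apply: (@le_trans _ _ (\sum_(r < N) 2 * (`|h s| * rho n.+1 s))); last first.
    rewrite sumr_const card_ord -mulr_natl le_eqVlt; apply/orP; left; apply/eqP; ring.
  apply: ler_sum => r _; rewrite normrM.
  (* [near_rational] says nothing about coordinates of weight zero, but the hyperplane does not
     involve them. *)
  have [ir|/hJ ->] := boolP (0 < i r); last first.
    by rewrite normr0 mul0r; have := rho_gt0 n.+1 s; have := normr_ge0 (h s); nra.
  have := smax r; have := qp r ir; have := normr_ge0 (h r); nra.
have cF : #|Fam| = (\prod_r m r)%N by rewrite cardsE card_family_ltn.
have cG : (uphalf (\prod_r m r) <= #|Fam :\: D|)%N.
  rewrite finset.cardsD (finset.setIidPr DFam) cF.
  by move: (\prod_r m r)%N cD => P; rewrite uphalf_half; lia.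
have Gsz : size (enum (Fam :\: D)) = #|Fam :\: D| by rewrite cardE.
pose f0 : {ffun 'I_N -> 'I_B.+1} := [ffun=> ord0].
pose fu u := nth f0 (enum (Fam :\: D)) u.
have fuG u : (u < uphalf (\prod_r m r))%N -> fu u \in Fam :\: D.
  by move=> uM; rewrite -mem_enum mem_nth // Gsz; exact: leq_trans cG.
exists (fun u => pnt (fu u)); split.
- move=> u /fuG; rewrite inE => /andP[_ /FamP uF] r.
  by have [/(_ _ (uF r))] := HX r.
- move=> u /fuG; rewrite inE => /andP[uD uF] nr; move/negP: uD; apply.
  by rewrite inE uF; apply/asboolP.
- move=> u u' uM u'M uu'.
  have : fu u != fu u'.
    by rewrite nth_uniq ?enum_uniq // Gsz; apply: leq_trans cG.
  move=> /eqP ne; have [r fr] : exists r, fu u r != fu u' r.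
    by apply: contrapT => nr; apply: ne; apply/ffunP => r; apply: contrapT => /eqP e; apply: nr; exists r.
  exists r; have [_] := HX r; apply.
  + by move: (fuG _ uM); rewrite inE => /andP[_ /FamP].
  + by move: (fuG _ u'M); rewrite inE => /andP[_ /FamP].
  + by rewrite val_eqE.
Qed.

Lemma uphalf_prod_gt0 : (0 < uphalf (\prod_r m r))%N.
Proof.
have : (0 < \prod_r m r)%N by apply: prodn_gt0 => r; have := m_large r; lia.
by case: (\prod_r m r)%N.
Qed.

(** The [M]-adic digits of [v] record the path to a node: the parent is [v %/ M] and the last choice
    [v %% M]. The first three properties then hold for every integer [v], and only separation needs
    [v < M ^ n]. *)
Lemma tree_exists (c0 : 'I_N -> R) : (forall r, Om r (c0 r)) ->
  let M := uphalf (\prod_r m r) in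
  exists ctr : nat -> nat -> 'I_N -> R,
  [/\ forall n v r, Om r (ctr n v r),
      forall n v r, `|ctr n.+1 v r - ctr n (v %/ M)%N r| <= rho n r / 2,
      forall n v, ~ near_rational n (ctr n.+1 v) &
      forall n v v', (v < M ^ n)%N -> (v' < M ^ n)%N -> v != v' ->
        exists r, 3 * rho n r <= `|ctr n v r - ctr n v' r|].
Proof.
move=> Oc0 M; have M0 : (0 < M)%N := uphalf_prod_gt0.
have /choice[ch chP] : forall nc : nat * ('I_N -> R), exists ch : nat -> 'I_N -> R,
    (forall r, Om r (nc.2 r)) ->
  [/\ forall u, (u < M)%N -> forall r, Om r (ch u r) /\ `|ch u r - nc.2 r| <= rho nc.1 r / 2,
      forall u, (u < M)%N -> ~ near_rational nc.1 (ch u) &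
      forall u u', (u < M)%N -> (u' < M)%N ->
        u != u' -> exists r, 3 * rho nc.1.+1 r <= `|ch u r - ch u' r|].
  move=> [n c]; have [Oc|nOc] := pselect (forall r, Om r (c r)).
    by have [ch chP] := children_exist n Oc; exists ch.
  by exists (fun _ => c0) => /nOc.
pose ctr := fix ctr n v : 'I_N -> R :=
  if n is n'.+1 then ch (n', ctr n' (v %/ M)%N) (v %% M)%N else c0.
have mM v : (v %% M < M)%N by rewrite ltn_mod.
have Octr n v r : Om r (ctr n v r).
  elim: n v r => [//|n IH] v r /=.
  by have [/(_ _ (mM v) r)[]] := chP (n, ctr n (v %/ M)%N) (IH _).
exists ctr; split => //.
- move=> n v r /=.
  by have [/(_ _ (mM v) r)[]] := chP (n, ctr n (v %/ M)%N) (Octr _ _).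
- move=> n v /=.
  by have [_ /(_ _ (mM v))] := chP (n, ctr n (v %/ M)%N) (Octr _ _).
- elim=> [|n IH] v v'; first by rewrite expn0 !ltnS !leqn0 => /eqP-> /eqP->; rewrite eqxx.
  rewrite expnSr -!ltn_divLR // => vM v'M vv'.
  have [E|pp] := eqVneq (v %/ M)%N (v' %/ M)%N.
    have mm : (v %% M != v' %% M)%N.
      by apply: contra vv' => /eqP e; rewrite (divn_eq v M) (divn_eq v' M) E e.
    have [_ _ /(_ _ _ (mM v) (mM v') mm)] := chP (n, ctr n (v %/ M)%N) (Octr _ _).
    by rewrite /= E.
  (* Distinct parents: the spacing 3 rho_n shrinks by at most twice rho_n / 2, and 2 rho_n >= 8
     rho_(n+1). *)
  have [r h] := IH _ _ vM v'M pp; exists r.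
  have h1 : `|ctr n.+1 v r - ctr n (v %/ M)%N r| <= rho n r / 2.
    by have [/(_ _ (mM v) r)[]] := chP (n, ctr n (v %/ M)%N) (Octr _ _).
  have h2 : `|ctr n.+1 v' r - ctr n (v' %/ M)%N r| <= rho n r / 2.
    by have [/(_ _ (mM v') r)[]] := chP (n, ctr n (v' %/ M)%N) (Octr _ _).
  have h3 := rhoS n r; have h4 := rho_gt0 n r.
  have : `|ctr n (v %/ M)%N r - ctr n (v' %/ M)%N r| <=
     `|ctr n.+1 v r - ctr n.+1 v' r| + rho n r.
    have -> : ctr n (v %/ M)%N r - ctr n (v' %/ M)%N r =
      (ctr n.+1 v r - ctr n.+1 v' r) - ((ctr n.+1 v r - ctr n (v %/ M)%N r) -
      (ctr n.+1 v' r - ctr n (v' %/ M)%N r)) by ring.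
    apply: le_trans (ler_normB _ _) _; rewrite lerD2l.
    apply: le_trans (ler_normB _ _) _; lra.
  lra.
Qed.

Lemma rho_le n r : rho n r * n.+1%:R <= rho0.
Proof.
elim: n => [|n IH]; first by rewrite /rho expr0 divr1 mulr1.
apply: le_trans IH; have := rhoS n r; have := rho_gt0 n.+1 r; have : 0 <= n%:R :> R by [].
rewrite -!natr1; nra.
Qed.

Hypothesis Om_closed : forall r, closed (Om r).

(** For given [q] the level [n] with k^n <= q < k^(n+1) is the one at which rationals of denominator
    [q] were avoided, for every numerator and in particular for the nearest integers. *)
Lemma limit_bad (ctr : nat -> nat -> 'I_N -> R) (M : nat) (v : nat -> nat) :
  (forall n u r, Om r (ctr n u r)) ->
  (forall n u r, `|ctr n.+1 u r - ctr n (u %/ M)%N r| <= rho n r / 2) ->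
  (forall n u, ~ near_rational n (ctr n.+1 u)) ->
  (forall n, v n = v n.+1 %/ M)%N ->
  exists x : 'I_N -> R, [/\ forall r, Om r (x r), Bad i x &
    forall n r, `|x r - ctr n (v n) r| <= rho n r].
Proof.
move=> Oc cS nr vS.
have /choice[x xP] : forall r, exists x, forall n, `|x - ctr n (v n) r| <= rho n r.
  move=> r; apply: nested_limit => [n|n|n]; [exact: rho_gt0|exact: rhoS|].
  by rewrite (vS n).
exists x; split => //.
  move=> r; apply: Om_closed => B /nbhs_ballP[e /= e0 eB].
  pose n := Num.truncn (rho0 / e).
  exists (ctr n (v n) r); split; first exact: Oc.
  apply: eB; rewrite -ball_normE /=; apply: le_lt_trans (xP r n) _.
  have n1 : rho0 < e * n.+1%:R by rewrite mulrC -ltr_pdivrMr //; exact: truncnS_gt.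
  by have := rho_le n r; have : 0 < n.+1%:R :> R by []; nra.
have k0 := k_gt0.
(* Replacing k^(n+1) by q and k^((n+1) i_r) by q^(i_r) in the box size loses a factor k each
   time. *)
pose e0 : R := rho0 / k%:R ^+ 2.
have e00 : 0 < e0 by rewrite divr_gt0 // exprn_gt0.
(* The minimum runs over all coordinates; for [i r = 0] the convention [0^-1 = 0] contributes the
   harmless value 1. *)
have [c c0 ce] := @ex_positive_lower_bound R N (fun r => e0 `^ (i r)^-1) (fun r => powR_gt0 _ e00).
exists c => // q q0.
have q0' : 0 < q%:R :> R by rewrite ltr0n.
have /choice[p pE] := fun r => dist_nearest_intE (q%:R * x r).
pose n := trunc_log k q.
have k1 : (1 < k)%N by lia.
have kq : (k ^ n <= q)%N by apply: trunc_logP.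
have qk : (q < k ^ n.+1)%N by apply: trunc_log_ltn.
have [r ir hr] : exists2 r, 0 < i r &
    2 * rho n.+1 r < `|ctr n.+1 (v n.+1) r - (p r)%:~R / q%:R|.
  apply: contrapT => nh; apply: (nr n (v n.+1)); exists q, p; split => // r ir.
  by rewrite leNgt; apply/negP => h; apply: nh; exists r.
apply: lt_le_trans (le_bigmax_cond _ (fun r => dist_nearest_int (q%:R * x r) `^ (i r)^-1) ir).
rewrite pE.
have xp : rho n.+1 r < `|x r - (p r)%:~R / q%:R|.
  have := xP r n.+1; rewrite distrC => h1.
  have := ler_normD (ctr n.+1 (v n.+1) r - x r) (x r - (p r)%:~R / q%:R).
  rewrite subrKA; lra.
have yp : e0 / q%:R `^ i r < `|q%:R * x r - (p r)%:~R|.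
  have -> : q%:R * x r - (p r)%:~R = (x r - (p r)%:~R / q%:R) * q%:R.
    by field; rewrite gt_eqF.
  rewrite normrM (gtr0_norm q0'); apply: le_lt_trans (_ : _ <= rho n.+1 r * q%:R) _; last first.
    by rewrite ltr_pM2r.
  (* One factor k^(i_r) is at most k because i_r <= 1; the remaining n are controlled by k^n <=
     q. *)
  have pk : (k%:R `^ i r) ^+ n.+1 <= k%:R * q%:R `^ i r.
    rewrite exprS; apply: ler_pM; rewrite ?exprn_ge0 ?powR_ge0 //.
      rewrite -[leRHS]powRr1 ?ler0n //; apply: ler_powR; first by rewrite ler1n ltnW.
      by rewrite -i1 (bigD1 r) //= lerDl sumr_ge0.
    rewrite -powR_mulrn ?powR_ge0 // -powRrM mulrC powRrM powR_mulrn ?ler0n //.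
    apply: ge0_ler_powR; rewrite ?nnegrE ?exprn_ge0 ?ler0n //.
    by rewrite -natrX ler_nat.
  have kn : k%:R ^+ n.+1 <= k%:R * q%:R :> R.
    by rewrite exprS ler_pM2l // -natrX ler_nat.
  have t0 : 0 < k%:R `^ i r :> R by rewrite powR_gt0.
  have t1 : 0 < q%:R `^ i r :> R by rewrite powR_gt0.
  have -> : rho n.+1 r * q%:R = rho0 * q%:R / (k%:R ^+ n.+1 * (k%:R `^ i r) ^+ n.+1).
    by rewrite /rho /rate exprMn mulrAC.
  rewrite /e0 ler_pdivlMr ?mulr_gt0 ?exprn_gt0 //.
  have -> : rho0 / k%:R ^+ 2 / q%:R `^ i r * (k%:R ^+ n.+1 * (k%:R `^ i r) ^+ n.+1) =
     (rho0 / (k%:R ^+ 2 * q%:R `^ i r)) * (k%:R ^+ n.+1 * (k%:R `^ i r) ^+ n.+1).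
    by field; rewrite !gt_eqF.
  have -> : rho0 * q%:R = (rho0 / (k%:R ^+ 2 * q%:R `^ i r)) * ((k%:R * q%:R) * (k%:R * q%:R `^ i r)).
    by field; rewrite !gt_eqF.
  rewrite ler_pM2l; last by rewrite divr_gt0 // mulr_gt0 // exprn_gt0.
  by apply: ler_pM; rewrite ?exprn_ge0 ?powR_ge0 ?ler0n.
have ii : 0 < (i r)^-1 by rewrite invr_gt0.
have w0 : 0 < e0 / q%:R `^ i r by rewrite divr_gt0 // powR_gt0.
apply: le_lt_trans (_ : _ <= (e0 / q%:R `^ i r) `^ (i r)^-1) _; last first.
  by apply: gt0_ltr_powR; rewrite ?nnegrE ?normr_ge0 ?ltW.
rewrite powR_div ?(ltW e00) ?powR_gt0 // -powRrM mulfV ?gt_eqF // powRr1 ?ler0n //.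
by rewrite ler_pM2r ?invr_gt0 //; exact: ce.
Qed.

End Cantor.

(** * Choice of a branch and counting by nets *)

(** Node [u] of level [n] becomes [u/M^n, (u+1)/M^n). Total length below 1 leaves some t in [0, 1)
    uncovered, and the integer parts of t M^n form the branch; half-open intervals make [v n] the
    index of the one containing t. *)
Lemma ex_avoiding_branch (R : realType) (M : nat) (lv : nat -> nat) (W : nat -> seq nat) :
  (0 < M)%N ->
  (\sum_(0 <= j <oo) ((size (W j))%:R / M%:R ^+ lv j : R)%:E < 1)%E ->
  exists v : nat -> nat, [/\ forall n, (v n < M ^ n)%N,
    forall n, v n = (v n.+1 %/ M)%N & forall j, v (lv j) \notin W j].
Proof.
move=> M0 small.
have M0' : 0 < M%:R :> R by rewrite ltr0n.
have Mn0 n : 0 < M%:R ^+ n :> R by rewrite exprn_gt0.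
pose I n u : set R := `[u%:R / M%:R ^+ n, u.+1%:R / M%:R ^+ n[%classic.
pose A j := \bigcup_(u in [set` W j]) I (lv j) u.
have mI n u : measurable (I n u) by exact: measurable_itv.
have muI n u : lebesgue_measure (I n u) = (M%:R ^- n)%:E.
  rewrite /I lebesgue_measure_itv /= lte_fin ltr_pM2r ?invr_gt0 // ltr_nat ltnSn.
  by rewrite -EFinD -mulrBl -natr1 addrAC subrr add0r mul1r.
have mA j : measurable (A j).
  by apply: fin_bigcup_measurable; first exact: finite_seq.
have [t [t0 t1] tA] : exists2 t : R, 0 <= t /\ t < 1 & forall j, ~ A j t.
  apply: contrapT => nt.
  have cov : (`[0, 1[%classic : set R) `<=` \bigcup_j A j.
    move=> t /=; rewrite in_itv /= => /andP[t0 t1].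
    by apply: contrapT => nA; apply: nt; exists t => // j Aj; apply: nA; exists j.
  have h : (lebesgue_measure (`[0%R, 1%R[%classic : set R) <=
      \sum_(0 <= j <oo) lebesgue_measure (A j))%E.
    exact: (@measure_sigma_subadditive _ _ _ (@lebesgue_measure R) _ _ mA (measurable_itv _) cov).
  rewrite lebesgue_measure_itv /= lte_fin ltr01 -EFinD subr0 in h.
  have : (1 < 1 :> \bar R)%E.
    apply: le_lt_trans h (le_lt_trans _ small).
    apply: lee_nneseries => // j _.
    apply: measure_bigcup_seq_le => [u|u _]; first exact: mI.
    by rewrite le_eqVlt; apply/orP; left; apply/eqP; exact: muI.
  by rewrite ltxx.
pose v n := Num.truncn (t * M%:R ^+ n).
have tM n : 0 <= t * M%:R ^+ n by rewrite mulr_ge0 // ltW.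
have vP n : (v n)%:R <= t * M%:R ^+ n < (v n).+1%:R by exact: truncn_itv.
exists v; split.
- move=> n; rewrite -(ltr_nat R) natrX.
  have /andP[h _] := vP n; apply: le_lt_trans h _.
  by rewrite -[ltRHS]mul1r ltr_pM2r.
- move=> n; have /andP[h1 h2] := vP n; have /andP[h3 h4] := vP n.+1.
  move: h3 h4; rewrite exprS (mulrCA t) => h3 h4.
  have a1 : (v n * M < (v n.+1).+1)%N.
    rewrite -(ltr_nat R) natrM mulrC; apply: le_lt_trans h4.
    by rewrite ler_pM2l.
  have a2 : (v n.+1 < (v n).+1 * M)%N.
    rewrite -(ltr_nat R) natrM mulrC; apply: le_lt_trans h3 _.
    by rewrite ltr_pM2l.
  apply/eqP; rewrite eqn_leq leq_divRL // -ltnS a1 /=.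
  by rewrite -ltnS ltn_divLR.
- move=> j; apply/negP => vW; apply: (tA j); exists (v (lv j)) => //=.
  rewrite /I /= in_itv /=; have /andP[h1 h2] := vP (lv j).
  by rewrite ler_pdivrMr // h1 ltr_pdivlMr.
Qed.

(** Each point is sent to a tuple of nearby net points. Points with the same tuple would differ by
    less than [2 * t r] in every coordinate. *)
Lemma card_net_prod (R : realType) N (s : 'I_N -> seq R) (t : 'I_N -> R)
    (T : eqType) (W : seq T) (c : T -> 'I_N -> R) :
  uniq W ->
  (forall v r, v \in W -> exists2 y, y \in s r & `|c v r - y| < t r) ->
  (forall v v', v \in W -> v' \in W -> v != v' ->
     exists r, 2 * t r <= `|c v r - c v' r|) ->
  (size W <= \prod_r size (s r))%N.
Proof.
move=> uW net sep.
have /choice[y yP] : forall vr : T * 'I_N, exists y, vr.1 \in W ->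
    y \in s vr.2 /\ `|c vr.1 vr.2 - y| < t vr.2.
  move=> [v r] /=; have [vW|nW] := boolP (v \in W); last by exists 0.
  by have [z zs zt] := net v r vW; exists z.
pose B := (\sum_r size (s r))%N.
have sB r : (size (s r) <= B.+1)%N.
  by rewrite /B (bigD1 r) //= -addnS leq_addr.
pose f v : {ffun 'I_N -> 'I_B.+1} := [ffun r => inord (index (y (v, r)) (s r))].
have fE v r : v \in W -> f v r = index (y (v, r)) (s r) :> nat.
  move=> vW; rewrite ffunE inordK //; apply: leq_trans (sB r).
  by rewrite index_mem; have [] := yP (v, r) vW.
have fi : {in W &, injective f}.
  move=> v v' vW v'W E; apply: contrapT => /eqP vv'.
  have [r] := sep v v' vW v'W vv'; apply/negP; rewrite -ltNge.
  have [ys yt] := yP (v, r) vW; have [ys' yt'] := yP (v', r) v'W.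
  have yy : y (v, r) = y (v', r).
    by rewrite -(nth_index 0 ys) -(nth_index 0 ys') -!fE // E.
  move: yt yt'; rewrite /= yy => yt yt'.
  have -> : c v r - c v' r = (c v r - y (v', r)) - (c v' r - y (v', r)) by ring.
  by apply: le_lt_trans (ler_normB _ _) _; lra.
rewrite -(size_map f) -(card_uniqP _); last by rewrite map_inj_in_uniq.
rewrite -(card_family_ltn sB); apply/subset_leq_card/fintype.subsetP => _ /mapP[v vW ->].
apply/familyP => r; rewrite inE fE // index_mem.
by have [] := yP (v, r) vW.
Qed.

Lemma powR_nat_unbounded (R : realType) (A d : R) : 0 < d ->
  exists k0 : nat, forall k, (k0 <= k)%N -> A <= k%:R `^ d.
Proof.
move=> d0; exists (Num.truncn (`|A| `^ d^-1)).+1 => k kk.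
have h : `|A| `^ d^-1 <= k%:R.
  apply: ltW; apply: lt_le_trans (truncnS_gt _) _.
  by rewrite ler_nat.
apply: le_trans (ler_norm _) _.
have -> : `|A| = (`|A| `^ d^-1) `^ d by rewrite -powRrM mulVf ?gt_eqF // powRr1.
by apply: ge0_ler_powR; rewrite ?nnegrE ?powR_ge0 ?ler0n // ltW.
Qed.

(** * Choice of the parameters and the lower bound *)

Section LowerBound.
Variables (R : realType) (N : nat) (Om : 'I_N -> set R) (i delta : 'I_N -> R).
Variables (mu : 'I_N -> {measure set R -> \bar R}) (r0 a b : R).
Hypotheses (i0 : forall r, 0 <= i r) (i1 : \sum_(r < N) i r = 1).
Hypotheses (r00 : 0 < r0) (a0 : 0 < a) (b0 : 0 < b).
Hypothesis delta0 : forall r, 0 < delta r.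
Hypothesis Om_compact : forall r, compact (Om r).
Hypothesis supp : forall r, supported_on (mu r) (Om r).
Hypothesis regular : forall r (c t : R), Om r c -> 0 < t -> t <= r0 ->
  ((a * t `^ delta r)%:E <= mu r (ball c t))%E /\
  (mu r (ball c t) <= (b * t `^ delta r)%:E)%E.

(** The count given by [ex_spaced] for radius rho_n / 2 and spacing 3 rho_(n+1), whose quotient is
    [rate i k r / 6]. *)
Definition branching (k : nat) (r : 'I_N) : nat :=
  Num.truncn (a / b * (rate i k r / 6) `^ delta r).

Lemma rate_ge k r : (0 < k)%N -> k%:R <= rate i k r.
Proof.
move=> k0; have k1 : 1 <= k%:R :> R by rewrite ler1n.
rewrite /rate -[leLHS]mulr1 ler_pM2l ?(lt_le_trans ltr01) //.
by rewrite -[leLHS](powRr0 k%:R); apply: ler_powR.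
Qed.

Lemma ahlfors_spaced_points k rho0 n r c : (6 <= k)%N -> 0 < rho0 -> 3 * rho0 <= r0 ->
  Om r c -> exists X : nat -> R,
  (forall u, (u < branching k r)%N -> Om r (X u) /\ `|X u - c| <= rho i k rho0 n r / 2) /\
  (forall u u', (u < branching k r)%N -> (u' < branching k r)%N -> u != u' ->
     3 * rho i k rho0 n.+1 r <= `|X u - X u'|).
Proof.
move=> k6 rho00 rr0 Oc.
have k4 : (4 <= k)%N := leq_trans (isT : (4 <= 6)%N) k6.
have k0 : (0 < k)%N := leq_trans (isT : (0 < 6)%N) k6.
have K6 : 6 <= k%:R :> R by rewrite ler_nat.
have rk := rate_ge r k0.
have w1 := @rho_gt0 R N i k rho0 i0 k4 rho00 n.+1 r.
have w0 := @rho_gt0 R N i k rho0 i0 k4 rho00 n r.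
have wE : rho i k rho0 n r = rho i k rho0 n.+1 r * rate i k r.
  rewrite /rho exprS; field; rewrite expf_neq0 gt_eqF //; lra.
have wle : rho i k rho0 n r <= rho0.
  rewrite /rho ler_pdivrMr; last by rewrite exprn_gt0 //; lra.
  by apply: ler_peMr; [exact: ltW|apply: exprn_ege1; lra].
have t0 : 0 < 3 * rho i k rho0 n.+1 r by lra.
have tD : 3 * rho i k rho0 n.+1 r <= rho i k rho0 n r / 2 by rewrite wE; nra.
have Dr : 3 * (rho i k rho0 n r / 2) <= r0 by lra.
have [s [sO sc ss]] := ex_spaced a0 b0 (Om_compact (r:=r)) (supp r) (@regular r) Oc t0 tD Dr.
have -> : rho i k rho0 n r / 2 / (3 * rho i k rho0 n.+1 r) = rate i k r / 6.
  by rewrite wE; field; rewrite gt_eqF.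
move=> ysz.
have bs : (branching k r <= size s)%N.
  rewrite -(ler_nat R) /branching; apply: le_trans ysz; rewrite truncn_le.
  by rewrite mulr_ge0 ?powR_ge0 // divr_ge0 // ltW.
exists (fun u => nth 0 s u); split.
  move=> u ub; have us : nth 0 s u \in s by rewrite mem_nth // (leq_trans ub).
  by split; [exact: sO|exact: sc].
move: ss => /(pairwiseP 0) ss u u' ub u'b.
rewrite neq_ltn => /orP[uu'|uu'].
  by apply: ss => //; rewrite inE (leq_trans _ bs).
by rewrite distrC; apply: ss => //; rewrite inE (leq_trans _ bs).
Qed.

(** All centres of nodes hit lie within w + d <= 2d of a fixed point of [U], so products of local
    nets of mesh [w n r] count them. *)
Lemma nodes_hit (ctr : nat -> nat -> 'I_N -> R) (w : nat -> 'I_N -> R) M n d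
    (U : set ('I_N -> R)) :
  (forall v r, Om r (ctr n v r)) ->
  (forall v v', (v < M ^ n)%N -> (v' < M ^ n)%N -> v != v' ->
     exists r, 3 * w n r <= `|ctr n v r - ctr n v' r|) ->
  (forall r, 0 < w n r) -> (forall r, w n r <= d) -> 0 < d -> 6 * d <= r0 ->
  (forall x y, U x -> U y -> forall r, `|x r - y r| <= d) ->
  exists W : seq nat,
    (size W)%:R <= \prod_r (b / a * (12 * d / w n r) `^ delta r) /\
    forall v, (v < M ^ n)%N ->
      (exists2 x, U x & forall r, `|x r - ctr n v r| <= w n r) -> v \in W.
Proof.
move=> Oc sep w0 wd d0 dr Ud.
have [[x0 Ux0]|nU] := pselect (exists x, U x); last first.
  exists [::]; split; last by move=> v _ [x Ux]; case: nU; exists x.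
  by apply: prodr_ge0 => r _; rewrite mulr_ge0 ?powR_ge0 // divr_ge0 // ltW.
have /choice[s sP] : forall r, exists s : seq R,
   (size s)%:R <= b / a * (6 * (2 * d) / w n r) `^ delta r /\
   (forall x : R, Om r x -> `|x - x0 r| <= 2 * d -> exists2 y : R, y \in s & `|x - y| < w n r).
  move=> r; apply: (local_net a0 b0 (@regular r)) => //; last by lra.
  by have := wd r; lra.
pose W := [seq v <- iota 0 (M ^ n) | `[< exists2 x, U x & forall r, `|x r - ctr n v r| <= w n r >] ].
exists W; split; last first.
  move=> v vM h; rewrite mem_filter; apply/andP; split; first exact/asboolP.
  by rewrite mem_iota add0n.
have hW : (size W <= \prod_r size (s r))%N.
  apply: (@card_net_prod _ _ s (w n) _ W (ctr n)); first by rewrite filter_uniq ?iota_uniq.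
    move=> v r; rewrite mem_filter => /andP[/asboolP[x Ux xv] _].
    have [_ sn] := sP r; apply: sn => //.
    have := xv r; have := Ud x x0 Ux Ux0 r; have := wd r.
    have := ler_normB (x r - x0 r) (x r - ctr n v r).
    rewrite (_ : x r - x0 r - (x r - ctr n v r) = ctr n v r - x0 r); last by ring.
    lra.
  move=> v v'; rewrite !mem_filter !mem_iota !add0n => /andP[_ vM] /andP[_ v'M] vv'.
  by have [r h] := sep v v' vM v'M vv'; exists r; have := w0 r; lra.
apply: (@le_trans _ _ (\prod_r (size (s r))%:R)); first by rewrite -natr_prod ler_nat.
apply: ler_prod => r _; rewrite ler0n /=; have [h _] := sP r.
by rewrite (_ : 12 * d = 6 * (2 * d)) //; ring.
Qed.

(** Rounding down a number whose integer part is at least 1 loses at most a factor 2 in each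
    coordinate; keeping half the children loses another. These losses do not depend on [k]. *)
Lemma branching_lower k : (forall r, (1 <= branching k r)%N) -> (0 < k)%N ->
  2^-1 * \prod_r (a / (2 * b) * (6 `^ delta r)^-1) * \prod_r rate i k r `^ delta r
    <= (uphalf (\prod_r branching k r))%:R.
Proof.
move=> b1 k0; apply: (@le_trans _ _ (2^-1 * (\prod_r branching k r)%:R)); last first.
  have : (\prod_r branching k r <= 2 * uphalf (\prod_r branching k r))%N.
    by move: (\prod_r branching k r)%N => P; rewrite uphalf_half; lia.
  by rewrite -(ler_nat R) natrM; lra.
rewrite -mulrA ler_pM2l ?invr_gt0 // -big_split natr_prod /=.
apply: ler_prod => r _; have rk := rate_ge r k0.
have K0 : 0 < k%:R :> R by rewrite ltr0n.
have rr : 0 < rate i k r by exact: lt_le_trans rk.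
apply/andP; split.
  by rewrite !mulr_ge0 ?powR_ge0 ?invr_ge0 ?powR_ge0 ?mulr_ge0 ?ltW.
have y0 : 0 <= a / b * (rate i k r / 6) `^ delta r.
  by rewrite mulr_ge0 ?powR_ge0 // divr_ge0 // ltW.
have := truncn_itv y0; rewrite -/(branching k r) powR_div ?(ltW rr) // => /andP[_ h].
have p6 : 0 < (6 : R) `^ delta r by rewrite powR_gt0.
have -> : a / (2 * b) / 6 `^ delta r * rate i k r `^ delta r =
   2^-1 * (a / b * (rate i k r `^ delta r / 6 `^ delta r)).
  by field; rewrite !gt_eqF.
have : 1 <= (branching k r)%:R :> R by rewrite ler1n.
by move: h; rewrite -natr1; lra.
Qed.

Lemma cantor_scheme s : (forall r, exists c, Om r c) -> 0 < s -> s < \sum_r delta r ->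
  exists (C d0 : R) (M : nat) (ctr : nat -> nat -> 'I_N -> R) (w : nat -> 'I_N -> R),
  [/\ 0 < C, 0 < d0, (0 < M)%N,
    forall v : nat -> nat, (forall n, v n = (v n.+1 %/ M)%N) ->
      exists x, [/\ forall r, Om r (x r), Bad i x &
        forall n r, `|x r - ctr n (v n) r| <= w n r] &
    forall (U : set ('I_N -> R)) d, 0 < d -> d <= d0 ->
      (forall x y, U x -> U y -> forall r, `|x r - y r| <= d) ->
      exists n, exists W : seq nat, (size W)%:R / M%:R ^+ n <= C * d `^ s /\
        forall v, (v < M ^ n)%N ->
          (exists2 x, U x & forall r, `|x r - ctr n v r| <= w n r) -> v \in W].
Proof.
move=> /choice[c0 Oc0] s0 ssig; set sig := \sum_r delta r.
pose eps := sig - s; have eps0 : 0 < eps by rewrite subr_gt0.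
pose kappa := 2^-1 * \prod_r (a / (2 * b) * (6 `^ delta r)^-1).
have kappa0 : 0 < kappa.
  rewrite mulr_gt0 // prodr_gt0 // => r _.
  by rewrite mulr_gt0 ?divr_gt0 ?mulr_gt0 ?invr_gt0 ?powR_gt0.
(* [k1] lets k^eps outweigh the loss 1/kappa per level; [k2] below ensures [m_large]. *)
have [k1 k1P] := powR_nat_unbounded kappa^-1 eps0.
have /choice[k2 k2P] : forall r, exists k2 : nat, forall k, (k2 <= k)%N ->
    (2 * (2 * N + 1))%:R * (b / a) * 6 `^ delta r <= k%:R `^ delta r.
  by move=> r; exact: powR_nat_unbounded.
pose k := (6 + k1 + \sum_r k2 r)%N.
have k6 : (6 <= k)%N by rewrite /k -addnA leq_addr.
have kk1 : (k1 <= k)%N by rewrite /k addnAC leq_addl.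
have kk2 r : (k2 r <= k)%N by rewrite /k (bigD1 r) //= addnCA leq_addr.
have k4 : (4 <= k)%N := leq_trans (isT : (4 <= 6)%N) k6.
have k0 : (0 < k)%N := leq_trans (isT : (0 < 6)%N) k6.
clearbody k.
have K0 : 0 < k%:R :> R by rewrite ltr0n.
have K1 : 1 <= k%:R :> R by rewrite ler1n.
have m_large r : (2 * (2 * N + 1) <= branching k r)%N.
  have y0 : 0 <= a / b * (rate i k r / 6) `^ delta r.
    by rewrite mulr_ge0 ?powR_ge0 // divr_ge0 // ltW.
  rewrite /branching truncn_ge_nat // powR_div ?(le_trans (ltW K0) (rate_ge r k0)) //.
  have p6 : 0 < (6 : R) `^ delta r by rewrite powR_gt0.
  rewrite -(ler_pM2r p6) mulrA divfK ?gt_eqF // -(ler_pM2l (divr_gt0 b0 a0)).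
  rewrite [leRHS]mulrA (_ : b / a * (a / b) = 1) ?mul1r; last by field; rewrite !gt_eqF.
  rewrite mulrCA mulrA; apply: le_trans (k2P r k (kk2 r)) _.
  by apply: ge0_ler_powR; rewrite ?nnegrE ?ler0n ?(ltW (delta0 r)) ?(le_trans _ (rate_ge r k0)) ?ler0n ?rate_ge.
(* The second entry makes the determinant bound 1/2; the first keeps all radii within the range of
   condition (A). *)
pose rho0 := Num.min (r0 / 6) (4 * (N.+1)`!%:R * k%:R ^+ 2)^-1.
have f0 : 0 < (N.+1)`!%:R :> R by rewrite ltr0n fact_gt0.
have rho00 : 0 < rho0.
  by rewrite lt_min divr_gt0 // invr_gt0 !mulr_gt0 // exprn_gt0.
have rho0r : 6 * rho0 <= r0.
  have : rho0 <= r0 / 6 by rewrite ge_min lexx.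
  lra.
have rho0_small : (N.+1)`!%:R * (2 * k%:R ^+ 2 * rho0) < 1.
  have kk : 0 < k%:R ^+ 2 :> R by rewrite exprn_gt0.
  have h : rho0 <= (4 * (N.+1)`!%:R * k%:R ^+ 2)^-1 by rewrite ge_min lexx orbT.
  apply: (@le_lt_trans _ _ ((N.+1)`!%:R * (2 * k%:R ^+ 2 * (4 * (N.+1)`!%:R * k%:R ^+ 2)^-1))).
    by rewrite !ler_pM2l // mulr_gt0.
  rewrite (_ : _ * _ = 2^-1); first by rewrite invf_lt1 // ltr1n.
  by field; rewrite !gt_eqF.
have [ctr [Oc cS nr sep]] := tree_exists i0 i1 k4 rho00 rho0_small m_large
  (fun n r c Oc => @ahlfors_spaced_points k rho0 n r c k6 rho00 ltac:(lra) Oc) Oc0.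
move: cS sep; set M := uphalf _ => cS sep.
have M0 : (0 < M)%N := uphalf_prod_gt0 k4 rho00 rho0_small m_large.
have M0' : 0 < M%:R :> R by rewrite ltr0n.
have Mlow : kappa * \prod_r rate i k r `^ delta r <= M%:R.
  apply: branching_lower => // r; apply: leq_trans (m_large r).
  by rewrite muln_gt0 addn1.
have rate0 r : 0 < rate i k r by exact: lt_le_trans (rate_ge r k0).
have Om_closed r : closed (Om r) by exact: compact_closed.
pose C1 := \prod_r (b / a * (12 / rho0) `^ delta r).
have C10 : 0 < C1.
  by rewrite prodr_gt0 // => r _; rewrite mulr_gt0 ?powR_gt0 ?divr_gt0.
pose w := rho i k rho0.
have w0 n r : 0 < w n r by exact: rho_gt0.
exists (C1 * (k%:R * rho0) `^ eps), rho0, M, ctr, w; split => //.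
- by rewrite mulr_gt0 ?powR_gt0 ?mulr_gt0.
- by move=> v vS; exact: (limit_bad i0 i1 k4 rho00 rho0_small Om_closed Oc cS nr vS).
move=> U d d0 dr Ud.
(* The least n with rho0 <= d k^n. The lower inequality makes every box radius at most [d]; the
   upper one gives k^n of order 1/d. *)
have [n nd dk] : exists2 n, rho0 <= d * k%:R ^+ n & d * k%:R ^+ n <= k%:R * rho0.
  have ex : exists n, rho0 <= d * k%:R ^+ n.
    have [n0 n0P] := powR_nat_unbounded (rho0 / d) ltr01.
    exists n0; have := n0P n0 (leqnn _); rewrite powRr1 ?ler0n // ler_pdivrMr // mulrC => h.
    apply: le_trans h _; rewrite ler_pM2l // -natrX ler_nat.
    by apply/ltnW/ltn_expl; apply: leq_trans k4.
  case: (ex_minnP ex) => [[|n]] nP nmin.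
    exists 0%N => //; rewrite expr0 mulr1; apply: le_trans dr _.
    by rewrite ler_peMl // ltW.
  exists n.+1 => //; rewrite exprS mulrCA ler_pM2l // leNgt.
  by apply/negP => /ltW/nmin; rewrite ltnn.
have kn0 : 0 < k%:R ^+ n :> R by rewrite exprn_gt0.
have wd r : w n r <= d.
  rewrite /w /rho ler_pdivrMr ?exprn_gt0 //; apply: le_trans nd _.
  rewrite ler_pM2l // lerXn2r ?nnegrE ?ler0n ?(ltW (rate0 r)) //.
  exact: rate_ge.
have d6 : 6 * d <= r0 by lra.
have [W [sW hW]] := nodes_hit (Oc n) (sep n) (w0 n) wd d0 d6 Ud.
exists n, W; split => //.
rewrite ler_pdivrMr ?exprn_gt0 //; apply: le_trans sW _.
have -> : \prod_r (b / a * (12 * d / w n r) `^ delta r) =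
   C1 * d `^ sig * (\prod_r rate i k r `^ delta r) ^+ n.
  rewrite /sig -prod_powR // -prodrXl -!big_split; apply: eq_bigr => r _ /=.
  rewrite -!mulrA; congr (_ * (_ * _)).
  rewrite -powR_mulrn ?powR_ge0 // -powRrM (mulrC (delta r)) powRrM powR_mulrn ?(ltW (rate0 r)) //.
  rewrite -!powRM ?mulr_ge0 ?exprn_ge0 ?invr_ge0 ?(ltW (rate0 r)) ?(ltW rho00) ?(ltW d0) //.
  congr (_ `^ _); rewrite /w /rho; field.
  by rewrite expf_neq0 ?gt_eqF.
have P0 : 0 < \prod_r rate i k r `^ delta r by rewrite prodr_gt0 // => r _; rewrite powR_gt0.
have Mn : kappa ^+ n * (\prod_r rate i k r `^ delta r) ^+ n <= M%:R ^+ n.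
  rewrite -exprMn lerXn2r ?nnegrE ?ler0n //.
  by rewrite mulr_ge0 // ltW.
(* Here the loss kappa^-n is paid for with d^eps. *)
have kap : d `^ eps <= (k%:R * rho0) `^ eps * kappa ^+ n.
  have h1 : (d * k%:R ^+ n) `^ eps <= (k%:R * rho0) `^ eps.
    by apply: ge0_ler_powR; rewrite ?nnegrE ?mulr_ge0 ?exprn_ge0 ?ler0n ?(ltW eps0) ?(ltW d0) ?(ltW rho00).
  have h2 : 1 <= (k%:R `^ eps) ^+ n * kappa ^+ n.
    rewrite -exprMn exprn_ege1 // -ler_pdivrMr // div1r.
    exact: k1P.
  have h3 : (k%:R ^+ n) `^ eps = (k%:R `^ eps) ^+ n.
    by rewrite -powR_mulrn ?ler0n // -powRrM mulrC powRrM powR_mulrn ?powR_ge0.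
  rewrite -[leLHS]mulr1.
  apply: le_trans (_ : d `^ eps * ((k%:R `^ eps) ^+ n * kappa ^+ n) <= _).
    by rewrite ler_pM2l ?powR_gt0.
  rewrite mulrA ler_pM2r ?exprn_gt0 // -h3 -powRM ?exprn_ge0 ?ler0n ?(ltW d0) //.
have -> : d `^ sig = d `^ eps * d `^ s.
  rewrite -powRD; first by rewrite /eps subrK.
  by apply/implyP => _; rewrite gt_eqF.
apply: le_trans (_ : C1 * (((k%:R * rho0) `^ eps * kappa ^+ n) * d `^ s) *
   (\prod_r rate i k r `^ delta r) ^+ n <= _).
  by rewrite ler_pM2r ?exprn_gt0 // ler_pM2l // ler_pM2r ?powR_gt0.
rewrite (_ : C1 * _ * _ = C1 * (k%:R * rho0) `^ eps * d `^ s *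
   (kappa ^+ n * (\prod_r rate i k r `^ delta r) ^+ n)); last by ring.
by rewrite ler_pM2l // !mulr_gt0 ?powR_gt0 ?mulr_gt0.
Qed.

End LowerBound.

(** * Hausdorff dimension *)

Section Hausdorff.
Variables (R : realType) (N : nat).
Implicit Types (F E U : set ('I_N -> R)) (s d : R).

Lemma supdist_le (x y : 'I_N -> R) d :
  0 <= d -> supdist x y <= d <-> forall r, `|x r - y r| <= d.
Proof.
move=> d0; split => [h r|h]; first by apply: le_trans h; exact: le_bigmax.
by apply/bigmax_leP; split => // r _; exact: h.
Qed.

Lemma diam_bounded F d : F !=set0 -> (diam F <= d%:E)%E ->
  exists e, [/\ diam F = e%:E, 0 <= e, e <= d &
    forall x y, F x -> F y -> forall r, `|x r - y r| <= e].
Proof.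
move=> [x0 Fx0] Fd.
have ub x y : F x -> F y -> ((supdist x y)%:E <= diam F)%E.
  by move=> Fx Fy; apply: ereal_sup_ubound; exists x, y.
have sd0 (x y : 'I_N -> R) : 0 <= supdist x y by exact: bigmax_ge_id.
have dF0 : (0 <= diam F)%E by apply: le_trans (ub _ _ Fx0 Fx0); rewrite lee_fin.
have fF : diam F \is a fin_num by rewrite ge0_fin_numE // (le_lt_trans Fd) // ltry.
exists (fine (diam F)); rewrite fineK //; split => //.
- by rewrite fine_ge0.
- by rewrite -lee_fin fineK.
- move=> x y Fx Fy; apply/supdist_le; first by rewrite fine_ge0.
  by rewrite -lee_fin fineK //; exact: ub.
Qed.

Lemma diam_le F d : 0 <= d ->
  (forall x y, F x -> F y -> forall r, `|x r - y r| <= d) -> (diam F <= d%:E)%E.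
Proof.
move=> d0 h; apply: ge_ereal_sup => _ [x [y [Fx [Fy ->]]]].
by rewrite lee_fin; apply/supdist_le => // r; exact: h.
Qed.

Lemma diam_pow0 s : diam_pow s (set0 : set ('I_N -> R)) = 0%E.
Proof. by rewrite /diam_pow; case: pselect. Qed.

Lemma diam_powE s F e : F !=set0 -> diam F = e%:E -> diam_pow s F = (e `^ s)%:E.
Proof.
move=> F0 dF; rewrite /diam_pow; case: (pselect (F = set0)) => [F00|nF0].
  by exfalso; case: F0 => x; rewrite F00.
by rewrite dF.
Qed.

Lemma diam_pow_ge0 s F : (0 <= diam_pow s F)%E.
Proof.
rewrite /diam_pow; case: (pselect (F = set0)) => // h; case: (diam F) => // e.
by rewrite lee_fin powR_ge0.
Qed.

Lemma hausdorff_delta_ge0 s d E : (0 <= hausdorff_delta s d E)%E.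
Proof.
apply: le_ereal_inf_tmp => _ [F [_ [_ ->]]].
by apply: nneseries_ge0 => n _ _; exact: diam_pow_ge0.
Qed.

Lemma hausdorff_measure_eq0 s E : hausdorff_measure s E = 0%E <->
  forall d, 0 < d -> hausdorff_delta s d E = 0%E.
Proof.
split=> [h d d0|h].
  apply/eqP; rewrite eq_le hausdorff_delta_ge0 andbT -h.
  by apply: ereal_sup_ubound; exists d.
apply/eqP; rewrite eq_le; apply/andP; split.
  by apply: ge_ereal_sup => _ [d /= d0 <-]; rewrite h.
by rewrite -(h 1 ltr01); apply: ereal_sup_ubound; exists 1 => //=.
Qed.

Lemma hausdorff_delta_subset s d E F : E `<=` F ->
  (hausdorff_delta s d E <= hausdorff_delta s d F)%E.
Proof.
move=> EF; apply: ereal_inf_le_tmp => _ [G [FG [Gd ->]]].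
by exists G; split => //; exact: subset_trans FG.
Qed.

Lemma hausdorff_dim_subset E F : E `<=` F -> (hausdorff_dim E <= hausdorff_dim F)%E.
Proof.
move=> EF; apply: ereal_inf_le_tmp => _ [s [s0 /hausdorff_measure_eq0 h] <-].
exists s => //; split => //; apply/hausdorff_measure_eq0 => d d0.
apply/eqP; rewrite eq_le hausdorff_delta_ge0 andbT -(h d d0).
exact: hausdorff_delta_subset.
Qed.

(* Instead of putting a measure on the Cantor set, the M-adic intervals of [0, 1)
   indexed by the nodes that are hit are shown not to cover [0, 1), by
   subadditivity of Lebesgue measure. *)
Lemma mass_distribution E s (C d0 : R) M (ctr : nat -> nat -> 'I_N -> R)
    (w : nat -> 'I_N -> R) : 0 < s -> 0 < C -> 0 < d0 -> (0 < M)%N ->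
  (forall v : nat -> nat, (forall n, v n = (v n.+1 %/ M)%N) ->
    exists2 x, E x & forall n r, `|x r - ctr n (v n) r| <= w n r) ->
  (forall U d, 0 < d -> d <= d0 ->
    (forall x y, U x -> U y -> forall r, `|x r - y r| <= d) ->
    exists n, exists W : seq nat, (size W)%:R / M%:R ^+ n <= C * d `^ s /\
      forall v, (v < M ^ n)%N ->
        (exists2 x, U x & forall r, `|x r - ctr n v r| <= w n r) -> v \in W) ->
  forall s', 0 <= s' -> s' <= s -> hausdorff_measure s' E != 0%E.
Proof.
move=> s0 C0 d00 M0 lim hit s' s'0 s's; apply/eqP => /hausdorff_measure_eq0 H.
(* The first entry keeps the total proportion below C (1/(4C) + e) <= 1/2; the second keeps the
   enlarged diameters [g] below [d0]. *)
pose e := Num.min (4 * C)^-1 (d0 `^ s).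
have e0 : 0 < e by rewrite lt_min invr_gt0 mulr_gt0 //= powR_gt0.
have eC : C * e <= 4^-1.
  have -> : 4^-1 = C * (4 * C)^-1 by field; rewrite gt_eqF.
  by rewrite ler_pM2l // ge_min lexx.
pose d1 := Num.min d0 1.
have d10 : 0 < d1 by rewrite lt_min d00 ltr01.
have [z [F [EF [Fd ->]]]] : exists2 z, (exists F : nat -> set ('I_N -> R),
     E `<=` \bigcup_n F n /\ (forall n, (diam (F n) <= d1%:E)%E) /\
     z = (\sum_(0 <= n <oo) diam_pow s' (F n))%E) & (z < (4 * C)^-1%:E)%E.
  by apply: ereal_inf_lt; rewrite -/(hausdorff_delta s' d1 E) H // lte_fin invr_gt0 mulr_gt0.
move=> Fsmall.
(* Covering sets may have diameter 0, whereas [hit] needs a positive one. Each is given an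
   allowance, and the allowances sum to at most [e]. *)
pose eta j := e / (2 ^ j.+1)%:R.
have eta0 j : 0 < eta j by rewrite divr_gt0 // ltr0n expn_gt0.
have etae j : eta j <= e.
  by rewrite ler_pdivrMr ?ltr0n ?expn_gt0 // ler_peMr ?(ltW e0) // ler1n expn_gt0.
have /choice[nW nWP] : forall j, exists nW : nat * seq nat,
    ((((size nW.2)%:R / M%:R ^+ nW.1 : R)%:E <= C%:E * (diam_pow s' (F j) + (eta j)%:E))%E) /\
    forall v, (v < M ^ nW.1)%N ->
        (exists2 x, F j x & forall r, `|x r - ctr nW.1 v r| <= w nW.1 r) -> v \in nW.2.
  move=> j; have [F0|nF0] := pselect (F j !=set0); last first.
    exists (0%N, [::]) => /=; split.
      rewrite mul0r mule_ge0 ?lee_fin ?(ltW C0) // adde_ge0 ?diam_pow_ge0 // lee_fin ltW //.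
    by move=> u _ [x Fx]; case: nF0; exists x.
  have [f [dF f0 fd fF]] := diam_bounded F0 (Fd j).
  have fd0 : f <= d0 by apply: le_trans fd _; rewrite ge_min lexx.
  have f1 : f <= 1 by apply: le_trans fd _; rewrite ge_min lexx orbT.
  pose g := Num.max f (eta j `^ s^-1).
  have g0 : 0 < g by rewrite lt_max powR_gt0 ?orbT.
  have ess x : 0 <= x -> (x `^ s^-1) `^ s = x.
    by move=> x0; rewrite -powRrM mulVf ?gt_eqF // powRr1.
  have ess' x : 0 <= x -> (x `^ s) `^ s^-1 = x.
    by move=> x0; rewrite -powRrM mulfV ?gt_eqF // powRr1.
  have gd : g <= d0.
    rewrite ge_max fd0 /= -[leRHS]ess' ?(ltW d00) //.
    apply: ge0_ler_powR; rewrite ?nnegrE ?powR_ge0 ?invr_ge0 ?(ltW s0) ?(ltW (eta0 j)) //.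
    by apply: le_trans (etae j) _; rewrite ge_min lexx orbT.
  have gs : g `^ s <= f `^ s' + eta j.
    have ff : f `^ s <= f `^ s'.
      have [->|fn] := eqVneq f 0.
        by rewrite powR0 ?powR_ge0 // gt_eqF.
      by apply: ger_powR => //; rewrite lt0r fn f0.
    rewrite /g; case: (leP f (eta j `^ s^-1)) => _.
      by rewrite ess ?(ltW (eta0 j)) // lerDr powR_ge0.
    by apply: le_trans ff _; rewrite lerDl ltW.
  have [|n [W [sW hW]]] := hit (F j) g g0 gd.
    move=> x y Fx Fy r; apply: le_trans (fF x y Fx Fy r) _.
    by rewrite le_max lexx.
  exists (n, W); split => //=.
  rewrite (diam_powE _ F0 dF) -EFinD -EFinM lee_fin; apply: le_trans sW _.
  by rewrite ler_pM2l.
have small : (\sum_(0 <= j <oo) ((size (nW j).2)%:R / M%:R ^+ (nW j).1 : R)%:E < 1)%E.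
  apply: (@le_lt_trans _ _ (\sum_(0 <= j <oo) (C%:E * (diam_pow s' (F j) + (eta j)%:E)))%E).
    apply: lee_nneseries => // j _.
    by have [] := nWP j.
  rewrite nneseriesZl; last by move=> j _; rewrite adde_ge0 ?diam_pow_ge0 // lee_fin ltW.
  apply: (@le_lt_trans _ _ (C%:E * (\sum_(0 <= j <oo) diam_pow s' (F j) + e%:E))%E).
    rewrite lee_pmul2l ?lte_fin //.
    by apply: epsilon_trick => [j|]; [exact: diam_pow_ge0|exact: ltW].
  apply: (@le_lt_trans _ _ (C%:E * ((4 * C)^-1%:E + e%:E))%E).
    by rewrite lee_pmul2l ?lte_fin // leeD2r // ltW.
  rewrite -EFinD -EFinM lte_fin mulrDr.
  have -> : C * (4 * C)^-1 = 4^-1 by field; rewrite gt_eqF.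
  lra.
have [v [vM vS vW]] := ex_avoiding_branch (lv := fun j => (nW j).1) (W := fun j => (nW j).2) M0 small.
have [x Ex xv] := lim v vS.
have [j _ Fx] := EF x Ex.
have [_ /(_ _ (vM _))] := nWP j.
move=> h; have := vW j; rewrite h //; exists x => // r; exact: xv.
Qed.

Lemma nneseries_le_count (f : nat -> \bar R) n (c : R) : 0 <= c ->
  (forall j, (0 <= f j)%E) -> (forall j, (j < n)%N -> (f j <= c%:E)%E) ->
  (forall j, (n <= j)%N -> f j = 0%E) ->
  (\sum_(0 <= j <oo) f j <= (n%:R * c)%:E)%E.
Proof.
move=> c0 f0 fc fz.
apply: lime_le; first by apply: is_cvg_nneseries => j _ _.
near=> K.
have nK : (n <= K)%N by near: K; exact: nbhs_infty_ge.
rewrite (big_cat_nat (n := n)) //= [X in (_ + X)%E]big_nat_cond [X in (_ + X)%E]big1; last first.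
  by move=> j /andP[/andP[nj _] _]; exact: fz.
rewrite adde0 big_mkord; apply: le_trans (lee_sum _ (g := fun _ => c%:E) _) _.
  by move=> j _; exact: fc.
by rewrite sumEFin lee_fin sumr_const card_ord mulr_natl.
Unshelve. all: by end_near.
Qed.

(** At exponent [sig + e] the covering sum is at most C t^e, which tends to 0 with t. *)
Lemma hausdorff_dim_le E sig : 0 <= sig -> forall C, 0 <= C -> forall t0, 0 < t0 ->
  (forall t, 0 < t -> t <= t0 -> exists (T : finType) (B : T -> set ('I_N -> R)),
     [/\ E `<=` \bigcup_z B z, forall z, (diam (B z) <= t%:E)%E &
         #|T|%:R <= C * t `^ (- sig)]) ->
  (hausdorff_dim E <= sig%:E)%E.
Proof.
move=> sig0 C C0 t0 t00 cov; apply/lee_addgt0Pr => e e0.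
apply: ereal_inf_lbound; exists (sig + e) => //; split; first by rewrite addr_ge0 // ltW.
apply/hausdorff_measure_eq0 => d d0.
apply/eqP; rewrite eq_le hausdorff_delta_ge0 andbT.
apply/lee_addgt0Pr => g g0; rewrite add0e.
(* The last entry gives (C + 1) t^e <= g; adding 1 avoids dividing by zero when C = 0. *)
pose t := Num.min (Num.min t0 d) ((g / (C + 1)) `^ e^-1).
have C1 : 0 < C + 1 by lra.
have gC0 : 0 < g / (C + 1) by rewrite divr_gt0.
have t_gt0 : 0 < t by rewrite !lt_min t00 d0 powR_gt0.
have [|T [B [EB Bt cB]]] := cov t t_gt0; first by rewrite !ge_min lexx.
(* The finite cover is padded by empty sets, to which [diam_pow] assigns 0. *)
pose F j := if insub j is Some u then B (enum_val (u : 'I_#|T|)) else set0.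
apply: (@le_trans _ _ (\sum_(0 <= j <oo) diam_pow (sig + e) (F j))%E).
  apply: ereal_inf_lbound; exists F; split.
    move=> x /EB[z _ Bx]; exists (enum_rank z) => //.
    by rewrite /F valK enum_rankK.
  split => // j; rewrite /F; case: insubP => [u _ _|_].
    by apply: le_trans (Bt _) _; rewrite lee_fin !ge_min lexx orbT.
  by apply: diam_le => [|x y []]; exact: ltW.
apply: (@le_trans _ _ (#|T|%:R * t `^ (sig + e))%:E).
  apply: nneseries_le_count => [|j|j jT|j jT].
  - exact: powR_ge0.
  - exact: diam_pow_ge0.
  - rewrite /F; case: insubP => [u _ _|_]; last by rewrite diam_pow0 lee_fin powR_ge0.
    have [B0|nB0] := pselect (B (enum_val u) !=set0); last first.
      have -> : B (enum_val u) = set0.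
        by rewrite -subset0 => x Bx; apply: nB0; exists x.
      by rewrite diam_pow0 lee_fin powR_ge0.
    have [f [dB f0 ft _]] := diam_bounded B0 (Bt _).
    rewrite (diam_powE _ B0 dB) lee_fin; apply: ge0_ler_powR => //; rewrite ?nnegrE ?(ltW t_gt0) //.
    by rewrite addr_ge0 // ltW.
  - by rewrite /F insubF ?diam_pow0 // ltnNge jT.
rewrite lee_fin powRD; last by apply/implyP => _; rewrite gt_eqF.
have ts : 0 < t `^ sig by rewrite powR_gt0.
apply: (@le_trans _ _ (C * t `^ e)).
  rewrite mulrA ler_pM2r ?powR_gt0 // -ler_pdivlMr //.
  by rewrite -powRN.
have te : t `^ e <= g / (C + 1).
  have -> : g / (C + 1) = ((g / (C + 1)) `^ e^-1) `^ e.
    by rewrite -powRrM mulVf ?gt_eqF // powRr1 // ltW.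
  apply: ge0_ler_powR; rewrite ?nnegrE ?powR_ge0 ?(ltW e0) ?(ltW t_gt0) //.
  by rewrite ge_min lexx orbT.
apply: le_trans (_ : (C + 1) * t `^ e <= _); last by rewrite mulrC -ler_pdivlMr.
by rewrite ler_pM2r ?powR_gt0 //; lra.
Qed.

End Hausdorff.

(** * Uniform constants and conclusion *)

Lemma condA_uniform (R : realType) N (mu : 'I_N -> {measure set R -> \bar R})
    (Om : 'I_N -> set R) (delta : 'I_N -> R) :
  (forall r, condA (mu r) (Om r) (delta r)) ->
  exists r0 a b : R, [/\ 0 < r0, 0 < a, 0 < b &
    forall r (c t : R), Om r c -> 0 < t -> t <= r0 ->
      ((a * t `^ delta r)%:E <= mu r (ball c t))%E /\
      (mu r (ball c t) <= (b * t `^ delta r)%:E)%E].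
Proof.
move=> A.
have /choice[f fP] : forall r, exists f : R * R * R,
  [/\ 0 < f.1.1, 0 < f.1.2, 0 < f.2 & forall c t : R, Om r c -> 0 < t -> t <= f.1.1 ->
      ((f.1.2 * t `^ delta r)%:E <= mu r (ball c t))%E /\
      (mu r (ball c t) <= (f.2 * t `^ delta r)%:E)%E].
  move=> r; have [r0 [a [b [r00 a0 a1 b1 h]]]] := A r.
  by exists (r0, a, b); split => //=; exact: lt_le_trans b1.
have [r0 r00 r0P] := @ex_positive_lower_bound R N (fun r => (f r).1.1)
  ltac:(by move=> r; have [] := fP r).
have [a a0 aP] := @ex_positive_lower_bound R N (fun r => (f r).1.2)
  ltac:(by move=> r; have [] := fP r).
pose b := \big[Num.max/1]_r (f r).2.
have b0 : 0 < b := lt_le_trans ltr01 (bigmax_ge_id _ _ _ _).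
exists r0, a, b; split => // r c t Oc t0 tr.
have [_ _ _ /(_ c t Oc t0 (le_trans tr (r0P r)))[h1 h2]] := fP r; split.
  apply: le_trans h1; rewrite lee_fin; apply: ler_wpM2r; first exact: powR_ge0.
  exact: aP.
apply: (le_trans h2); rewrite lee_fin; apply: ler_wpM2r; first exact: powR_ge0.
exact: le_bigmax.
Qed.

Theorem theorem6 (R : realType) (N : nat) (Om : 'I_N -> set R)
  (m : 'I_N -> {measure set R -> \bar R}) (delta : 'I_N -> R)
  (i : 'I_N -> R) :
  (forall j, compact (Om j)) ->
  (forall j, supported_on (m j) (Om j)) ->
  (forall j, non_atomic (m j)) ->
  (forall j, finite_meas (m j)) ->
  (forall j, condA (m j) (Om j) (delta j)) ->
  (forall j, 0 <= i j) ->
  \sum_(j < N) i j = 1 ->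
  let Omega := [set x : 'I_N -> R | forall j, Om j (x j)] in
  hausdorff_dim (Omega `&` Bad i) = hausdorff_dim Omega.
Proof.
move=> Omc supp na fm A i0 i1 Omega.
have [nO|nO] := pselect (exists j, ~ (Om j !=set0)).
  have -> : Omega = set0.
    by case: nO => j nj; rewrite -subset0 => x Ox; apply: nj; exists (x j); exact: Ox.
  by rewrite set0I.
have On j : exists c, Om j c.
  by apply: contrapT => nc; apply: nO; exists j => -[c Oc]; apply: nc; exists c.
have delta0 j : 0 < delta j.
  by apply: (condA_exponent_gt0 (na j) (fm j) (A j)); exact: On.
have [r0 [a [b [r00 a0 b0 reg]]]] := condA_uniform A.
set sig := \sum_(j < N) delta j.
have sig_gt0 : 0 < sig.
  have [j _] := ex_weight_gt0 i0 i1.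
  by rewrite /sig (bigD1 j) //= ltr_pwDl // sumr_ge0 // => r _; exact: ltW.
apply/eqP; rewrite eq_le hausdorff_dim_subset //=.
apply: (@le_trans _ _ sig%:E).
  have /choice[C CP] : forall r, exists C : R, 0 <= C /\ forall t : R, 0 < t -> t <= r0 ->
      exists s : seq R, (size s)%:R <= C * t `^ (- delta r) /\
      forall x, Om r x -> exists2 y, y \in s & `|x - y| < t.
    by move=> r; have [C C0 h] := global_net a0 (fm r) (reg r); exists C.
  (* Products of nets of mesh t/2 give boxes of diameter at most t, hence the factors of 1/2 in the
     constant. *)
  apply: (@hausdorff_dim_le _ _ _ _ (ltW sig_gt0) (\prod_r (C r * 2^-1 `^ (- delta r))) _ r0 r00).
    by apply: prodr_ge0 => r _; rewrite mulr_ge0 ?powR_ge0 //; have [] := CP r.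
  move=> t t0 tr; have t20 : 0 < 2^-1 * t by lra.
  have t2r : 2^-1 * t <= r0 by lra.
  have /choice[s sP] : forall r, exists s : seq R, (size s)%:R <= C r * (2^-1 * t) `^ (- delta r) /\
      forall x, Om r x -> exists2 y, y \in s & `|x - y| < 2^-1 * t.
    by move=> r; have [_ /(_ _ t20 t2r)] := CP r.
  pose B := (\sum_r size (s r))%N.
  have sB r : (size (s r) <= B.+1)%N by rewrite /B (bigD1 r) //= -addnS leq_addr.
  pose Fam : {pred {ffun 'I_N -> 'I_B.+1}} :=
    family (fun r : 'I_N => [pred x : 'I_B.+1 | (x < size (s r))%N]).
  pose box (f : {f : {ffun 'I_N -> 'I_B.+1} | f \in Fam}) : set ('I_N -> R) :=
    [set x | forall r, `|x r - nth 0 (s r) (sval f r)| <= 2^-1 * t].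
  exists {f : {ffun 'I_N -> 'I_B.+1} | f \in Fam}, box; split.
  - move=> x Ox.
    have /choice[y yP] : forall r, exists y : R, y \in s r /\ `|x r - y| < 2^-1 * t.
      by move=> r; have [_ /(_ _ (Ox r))[y ys yt]] := sP r; exists y.
    pose f : {ffun 'I_N -> 'I_B.+1} := [ffun r => inord (index (y r) (s r))].
    have fE r : f r = index (y r) (s r) :> nat.
      by rewrite ffunE inordK //; apply: leq_trans (sB r); rewrite index_mem; have [] := yP r.
    have fF : f \in Fam.
      by apply/familyP => r; rewrite inE fE index_mem; have [] := yP r.
    exists (exist _ f fF) => //= r; rewrite fE nth_index; last by have [] := yP r.
    by apply: ltW; have [] := yP r.
  - move=> f; apply: diam_le => [|x y /= hx hy r]; first exact: ltW.
    have -> : x r - y r = (x r - nth 0 (s r) (sval f r)) - (y r - nth 0 (s r) (sval f r)) by ring.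
    by apply: le_trans (ler_normB _ _) _; have := hx r; have := hy r; lra.
  - rewrite card_sig (card_family_ltn sB) natr_prod /sig -sumrN -prod_powR // -big_split /=.
    apply: ler_prod => r _; rewrite ler0n /= -mulrA -powRM ?(ltW t0) ?invr_ge0 //.
    by have [] := sP r.
apply: le_ereal_inf_tmp => _ [s /= [s0 Hs] <-]; rewrite lee_fin leNgt; apply/negP => ssig.
(* [s] may be 0, while the Cantor construction needs a positive exponent below [sig]. *)
pose s' := Num.max s (sig / 2).
have s'0 : 0 < s' by rewrite lt_max divr_gt0 ?orbT.
have s'sig : s' < sig by rewrite gt_max ssig /=; lra.
have ss' : s <= s' by rewrite le_max lexx.
have [C [d0 [M [ctr [w [C0 d00 M0 lim hit]]]]]] :=
  cantor_scheme i0 i1 r00 a0 b0 delta0 Omc supp reg On s'0 s'sig.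
have := mass_distribution (E := Omega `&` Bad i) s'0 C0 d00 M0 _ hit s0 ss'.
rewrite Hs eqxx => h; have : false by apply: h => v /lim[x [Ox Bx xv]]; exists x.
by [].
Qed.
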